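(* Let $\mathcal{O}$ be a UFD containing an uncountable field $\Bbbk$ of characteristic zero, and let $\mathcal{K}$ be an algebraic closure of the fraction field of $\mathcal{O}$. Then the rings of Eisenstein series over $\mathcal{O}$, $$\mathcal{K}\{\!\{x_1,\ldots,x_n\}\!\}:=\bigcup_{\mathfrak{c}\in\mathcal{K}}\ \bigcup_{f\in\mathcal{O}\setminus\{0\}}\mathcal{O}_f[[x_1,\ldots,x_n]][\mathfrak{c}]\subset\mathcal{K}[[x_1,\ldots,x_n]],\qquad n\in\mathbb{N},$$ form a W-temperate family over $\mathcal{K}$.
   Context: $\mathcal{O}_f$ denotes the localization of $\mathcal{O}$ at the multiplicative family $\{1,f,f^2,\ldots\}$. Notation: $\mathbf{x}=(x_1,\ldots,x_n)$, $\mathbf{x}'=(x_1,\ldots,x_{n-1})$. Rings in other variable names are the same rings with variables renamed. Weierstrass family. Let $\mathcal{K}$ be a field of characteristic zero. A Weierstrass family over $\mathcal{K}$ is a family $(\mathcal{K}\{\!\{x_1,\ldots,x_n\}\!\})_{n\in\mathbb{N}}$ of $\mathcal{K}$-algebras such that: (i) for every $n$, $\mathcal{K}[\mathbf{x}]\subset\mathcal{K}\{\!\{\mathbf{x}\}\!\}\subset\mathcal{K}[[\mathbf{x}]]$; (ii) for all $n,m$, with $\mathbf{y}=(y_1,\ldots,y_m)$, $\mathcal{K}\{\!\{\mathbf{x},\mathbf{y}\}\!\}\cap\mathcal{K}[[\mathbf{x}]]=\mathcal{K}\{\!\{\mathbf{x}\}\!\}$; (iii) for any permutation $\sigma$ of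 $\{1,\ldots,n\}$ and $f\in\mathcal{K}\{\!\{\mathbf{x}\}\!\}$, $f(x_{\sigma(1)},\ldots,x_{\sigma(n)})\in\mathcal{K}\{\!\{\mathbf{x}\}\!\}$; (iv) if $f\in\mathcal{K}\{\!\{\mathbf{x}\}\!\}$ and $f(0)\neq0$, then $f$ is a unit in $\mathcal{K}\{\!\{\mathbf{x}\}\!\}$; (v) (Weierstrass division) if $F\in\mathcal{K}\{\!\{\mathbf{x}\}\!\}$ satisfies $F(0,x_n)=x_n^d u(x_n)$ with $u(0)\neq0$, then for every $G\in\mathcal{K}\{\!\{\mathbf{x}\}\!\}$ there are unique $Q\in\mathcal{K}\{\!\{\mathbf{x}\}\!\}$ and $R\in\mathcal{K}\{\!\{\mathbf{x}'\}\!\}[x_n]$ with $\deg_{x_n}(R)<d$ and $G=FQ+R$. W-temperate family. Let $\mathcal{K}$ be an uncountable algebraically closed field of characteristic zero. A W-temperate family over $\mathcal{K}$ is a Weierstrass family over $\mathcal{K}$ such that moreover: (a) for every $n>1$ and $f\in\mathcal{K}[[\mathbf{x}]]$, $f(\mathbf{x}',x_1x_n)\in\mathcal{K}\{\!\{\mathbf{x}\}\!\}\Rightarrow f(\mathbf{x})\in\mathcal{K}\{\!\{\mathbf{x}\}\!\}$; (b) for every $F\in\mathcal{K}[[\mathbf{x}]]\setminus\mathcal{K}\{\!\{\mathbf{x}\}\!\}$, setting $W=\{\lambda\in\mathcal{K}: F(\mathbf{x}',\lambda x_1)\in\mathcal{K}\{\!\{\mathbf{x}'\}\!\}\}$, the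 set $\mathcal{K}\setminus W$ is uncountable; (c) let $\mathbf{x}=(x_1,x_2)$, $\alpha\in\mathbb{N}^*$, and let $\Gamma(t,z)\in\mathcal{K}[t,z]$ be irreducible, monic in $z$, and split in $\mathcal{K}\{\!\{t\}\!\}[z]$; let $\gamma(t),\gamma'(t)\in\mathcal{K}\{\!\{t\}\!\}$ be two roots of $\Gamma$; let $P(\mathbf{x},z)=\sum_{k\in\mathbb{N}}x_1^kp_k(x_2,z)\in\mathcal{K}[[\mathbf{x}]][z]$ with $p_k\in\mathcal{K}[x_2,z]$ and $\deg_{x_2}(p_k)\le\alpha k$ for all $k$. Then $P(\mathbf{x},\gamma(x_2))\in\mathcal{K}\{\!\{\mathbf{x}\}\!\}\Rightarrow P(\mathbf{x},\gamma'(x_2))\in\mathcal{K}\{\!\{\mathbf{x}\}\!\}$. *)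

(* Defs.v *)
From HB Require Import structures.
From mathcomp Require Import all_boot all_order all_algebra all_fingroup.
From mathcomp Require Import boolp classical_sets cardinality.
From mathcomp Require Import mpoly.

Set Implicit Arguments.
Unset Strict Implicit.
Unset Printing Implicit Defensive.

Import GRing.Theory.
Local Open Scope ring_scope.

(* R[[x_1, ..., x_n]]; the variable x_i has index i - 1 in 'I_n *)
Record mps (n : nat) (R : Type) : Type := MPS { mpscoef :> 'X_{1..n} -> R }.
Notation "{ 'mps' R [ n ] }" := (mps n R) (R at level 2, format "{ 'mps'  R [ n ] }").

HB.instance Definition _ n R := gen_eqMixin {mps R[n]}.
HB.instance Definition _ n R := gen_choiceMixin {mps R[n]}.

Section MpsRing.
Variables (n : nat) (R : comNzRingType).
Implicit Types (f g h : {mps R[n]}) (p q : {mpoly R[n]}) (m : 'X_{1..n}).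

Lemma mpsP f g : (forall m, f m = g m) -> f = g.
Proof. by case: f; case: g => a b /= /funext ->. Qed.

Definition mps_of_mpoly p : {mps R[n]} := MPS (fun m => p@_m).

Definition mps_add f g : {mps R[n]} := MPS (fun m => f m + g m).
Definition mps_opp f : {mps R[n]} := MPS (fun m => - f m).
Definition mps_mul f g : {mps R[n]} :=
  MPS (fun m => \sum_(k : 'X_{1..n < (mdeg m).+1, (mdeg m).+1}
                       | m == (k.1 + k.2)%MM) f k.1 * g k.2).
Definition mps_scale (c : R) f : {mps R[n]} := MPS (fun m => c * f m).

Fact mps_addA : associative mps_add.
Proof. by move=> f g h; apply: mpsP => m /=; rewrite addrA. Qed.
Fact mps_addC : commutative mps_add.
Proof. by move=> f g; apply: mpsP => m /=; rewrite addrC. Qed.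
Fact mps_add0 : left_id (mps_of_mpoly 0) mps_add.
Proof. by move=> f; apply: mpsP => m /=; rewrite mcoeff0 add0r. Qed.
Fact mps_addN : left_inverse (mps_of_mpoly 0) mps_opp mps_add.
Proof. by move=> f; apply: mpsP => m /=; rewrite mcoeff0 addNr. Qed.

HB.instance Definition _ := GRing.isZmodule.Build {mps R[n]}
  mps_addA mps_addC mps_add0 mps_addN.

Definition mps_trunc d f : {mpoly R[n]} :=
  \sum_(m : 'X_{1..n < d}) f m *: 'X_[m].

Lemma mps_truncE d f m : (mdeg m < d)%N -> (mps_trunc d f)@_m = f m.
Proof. exact: mcoeff_mpoly. Qed.

(* a coefficient of a product only involves coefficients of lower degree, so
   it can be computed in {mpoly R[n]} *)
Lemma mps_mul_mpoly d f g p q m : (mdeg m < d)%N ->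
    (forall k, (mdeg k < d)%N -> p@_k = f k) ->
    (forall k, (mdeg k < d)%N -> q@_k = g k) ->
  mps_mul f g m = (p * q)@_m.
Proof.
move=> md fp gq; rewrite mcoeffM /=; apply: eq_bigr => -[k1 k2] /=.
by rewrite fp ?gq // (leq_trans (bmdeg _)).
Qed.

Fact mps_mulC : commutative mps_mul.
Proof.
move=> f g; apply: mpsP => m.
rewrite (@mps_mul_mpoly _ f g _ _ m (ltnSn _) (mps_truncE f) (mps_truncE g)).
rewrite (@mps_mul_mpoly _ g f _ _ m (ltnSn _) (mps_truncE g) (mps_truncE f)).
by rewrite mulrC.
Qed.

Fact mps_mulA : associative mps_mul.
Proof.
move=> f g h; apply: mpsP => m.
pose T := mps_trunc (mdeg m).+1.
have TE e k : (mdeg k < (mdeg m).+1)%N -> (T e)@_k = e k by exact: mps_truncE.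
have TM e1 e2 k : (mdeg k < (mdeg m).+1)%N ->
    (T e1 * T e2)@_k = mps_mul e1 e2 k.
  by move=> km; rewrite (mps_mul_mpoly km (TE e1) (TE e2)).
rewrite (mps_mul_mpoly (ltnSn _) (TE f) (TM g h)).
by rewrite (mps_mul_mpoly (ltnSn _) (TM f g) (TE h)) mulrA.
Qed.

Fact mps_mul1 : left_id (mps_of_mpoly 1) mps_mul.
Proof.
move=> f; apply: mpsP => m.
rewrite (@mps_mul_mpoly _ _ f 1 _ m (ltnSn _) _ (mps_truncE f)) //.
by rewrite mul1r mps_truncE.
Qed.

Fact mps_mulDl : left_distributive mps_mul mps_add.
Proof.
move=> f g h; apply: mpsP => m /=; rewrite -big_split /=.
by apply: eq_bigr => k _; rewrite mulrDl.
Qed.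

Fact mps_oner_neq0 : mps_of_mpoly 1 != 0.
Proof.
apply/eqP => /(congr1 (fun f : {mps R[n]} => f 0%MM)) /=.
by rewrite mcoeff1 mcoeff0 eqxx; apply/eqP/oner_neq0.
Qed.

HB.instance Definition _ := GRing.Zmodule_isComNzRing.Build {mps R[n]}
  mps_mulA mps_mulC mps_mul1 mps_mulDl mps_oner_neq0.

Fact mps_scaleA a b f : mps_scale a (mps_scale b f) = mps_scale (a * b) f.
Proof. by apply: mpsP => m /=; rewrite mulrA. Qed.
Fact mps_scale1 : left_id 1 mps_scale.
Proof. by move=> f; apply: mpsP => m /=; rewrite mul1r. Qed.
Fact mps_scaleDr : right_distributive mps_scale +%R.
Proof. by move=> a f g; apply: mpsP => m /=; rewrite mulrDr. Qed.
Fact mps_scaleDl f : {morph mps_scale^~ f : a b / a + b}.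
Proof. by move=> a b; apply: mpsP => m /=; rewrite mulrDl. Qed.

HB.instance Definition _ := GRing.Zmodule_isLmodule.Build R {mps R[n]}
  mps_scaleA mps_scale1 mps_scaleDr mps_scaleDl.

Fact mps_scaleAl (a : R) f g : a *: (f * g) = (a *: f) * g.
Proof.
apply: mpsP => m /=; rewrite mulr_sumr.
by apply: eq_bigr => k _; rewrite mulrA.
Qed.

HB.instance Definition _ :=
  GRing.Lmodule_isLalgebra.Build R {mps R[n]} mps_scaleAl.
HB.instance Definition _ := GRing.Lalgebra_isComAlgebra.Build R {mps R[n]}.

Definition mpsX (i : 'I_n) : {mps R[n]} := mps_of_mpoly 'X_i.

End MpsRing.

Section Substitution.
Variable R : comNzRingType.

(* f(g_1, ..., g_n) for g_i without constant term: then g^k has order at least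
   |k|, so that only the terms f_k g^k with |k| <= |m| contribute to the
   coefficient at m.  Meaningless if some g_i has a constant term. *)
Definition mps_subst n p (g : 'I_n -> {mps R[p]}) (f : {mps R[n]}) :
    {mps R[p]} :=
  MPS (fun m => \sum_(k : 'X_{1..n < (mdeg m).+1})
                  f k * (\prod_(i < n) g i ^+ k i) m).

(* the tuple (g_1, ..., g_n, h) *)
Definition tuple_last n p (g : 'I_n -> {mps R[p]}) (h : {mps R[p]})
    (i : 'I_n.+1) : {mps R[p]} :=
  if unlift ord_max i is Some j then g j else h.

(* (x_1, ..., x_n), seen in R[[x_1, ..., x_{n+1}]] *)
Definition mpsX' n (i : 'I_n) : {mps R[n.+1]} := mpsX R (lift ord_max i).

Definition mps_of_poly n (P : {poly {mps R[n]}}) : {mps R[n.+1]} :=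
  (map_poly (mps_subst (@mpsX' n)) P).[mpsX R ord_max].

End Substitution.

Section Families.
Local Open Scope classical_set_scope.

Record weierstrass_family (K : fieldType) (A : forall n, set {mps K[n]}) :
    Prop := {
  wf_char0 : [pchar K] =i pred0;
  wf_subalg : forall n, GRing.subalg_closed (mem (A n));
  wf_poly : forall n (p : {mpoly K[n]}), A n (mps_of_mpoly p);
  wf_inter : forall n m (f : {mps K[n]}),
    A (n + m)%N (mps_subst (fun i => mpsX K (lshift m i)) f) <-> A n f;
  wf_perm : forall n (s : 'S_n) (f : {mps K[n]}),
    A n f -> A n (mps_subst (fun i => mpsX K (s i)) f);
  wf_unit : forall n (f : {mps K[n]}),
    A n f -> f 0%MM != 0 -> exists2 g, A n g & f * g = 1;
  wf_division : forall n d (F : {mps K[n.+1]}) (u : {mps K[1]}),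
    A n.+1 F ->
    mps_subst (tuple_last (fun _ : 'I_n => 0) (mpsX K ord0)) F
      = mpsX K ord0 ^+ d * u ->
    u 0%MM != 0 ->
    forall G, A n.+1 G ->
    exists! QP : {mps K[n.+1]} * {poly {mps K[n]}},
      [/\ A n.+1 QP.1, forall i, A n QP.2`_i, (size QP.2 <= d)%N
        & G = F * QP.1 + mps_of_poly QP.2]
}.

Definition irreducible_elt (R : idomainType) (p : R) : Prop :=
  [/\ p != 0, p \isn't a GRing.unit
    & forall a b, p = a * b -> a \is a GRing.unit \/ b \is a GRing.unit].

Definition associated (R : idomainType) (p q : R) : Prop :=
  exists2 u, u \is a GRing.unit & q = u * p.

Record ufd (R : idomainType) : Prop := {
  ufd_factor : forall x : R, x != 0 -> x \isn't a GRing.unit ->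
    exists2 s : seq R, {in s, forall p, irreducible_elt p}
                     & x = \prod_(p <- s) p;
  ufd_unique : forall s t : seq R,
    {in s, forall p, irreducible_elt p} ->
    {in t, forall p, irreducible_elt p} ->
    \prod_(p <- s) p = \prod_(p <- t) p ->
    exists t' : seq R, [/\ perm_eq t t', size s = size t'
      & forall i, (i < size s)%N -> associated s`_i t'`_i]
}.

(* In wt_blowup and wt_sections the number of variables is n + 2: x_1 has to
   be one of the variables x' for the substitutions to make sense.
   In wt_conj, elements of K[t, z] and K[x_2, z] are polynomials in z with
   coefficients polynomials in t, resp. x_2; x_1 and x_2 are the variables of
   index ord0 and ord_max. *)
Record W_temperate (K : closedFieldType) (A : forall n, set {mps K[n]}) :
    Prop := {
  wt_uncountable : ~ countable [set: K];
  wt_weierstrass : weierstrass_family A;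
  wt_blowup : forall n (f : {mps K[n.+2]}),
    A n.+2 (mps_subst (tuple_last (@mpsX' K n.+1)
                         (mpsX K ord0 * mpsX K ord_max)) f) ->
    A n.+2 f;
  wt_sections : forall n (F : {mps K[n.+2]}), ~ A n.+2 F ->
    let W := [set l : K |
      A n.+1 (mps_subst (tuple_last (@mpsX n.+1 K)
                           (l *: mpsX K ord0)) F)] in
    ~ countable (~` W);
  wt_conj : forall (alpha : nat) (Gamma : {poly {poly K}})
      (g g' : {mps K[1]}) (P : {poly {mps K[2]}}) (p : nat -> {poly {poly K}}),
    let GammaK : {poly {mps K[1]}} :=
      map_poly (horner_alg (mpsX K (@ord0 0))) Gamma in
    let at_x2 := mps_subst (fun _ : 'I_1 => mpsX K (@ord_max 1)) in
    (0 < alpha)%N ->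
    irreducible_elt Gamma -> Gamma \is monic ->
    (exists2 s : seq {mps K[1]}, {in s, forall r, A 1%N r}
       & GammaK = \prod_(r <- s) ('X - r%:P)) ->
    A 1%N g -> A 1%N g' -> root GammaK g -> root GammaK g' ->
    (forall j k l : nat, (P`_j) (U_(ord0) *+ k + U_(ord_max) *+ l)%MM
                   = (p k)`_j`_l) ->
    (forall j k : nat, (size ((p k)`_j)%R <= (alpha * k).+1)%N) ->
    A 2%N P.[at_x2 g] -> A 2%N P.[at_x2 g']
}.

(* O_f, inside the fraction field *)
Definition localization (O : idomainType) (f : O) : set {fraction O} :=
  [set q | exists a k, q = tofrac a / tofrac f ^+ k].

Definition mps_over n (R : Type) (B : set R) : set {mps R[n]} :=
  [set s | forall m, B (s m)].

(* B[c], for a subring B *)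
Definition adjoin (R : comNzRingType) (B : set R) (c : R) : set R :=
  [set x | exists2 P : {poly R}, (forall i, B P`_i) & x = P.[c]].

Definition eisenstein (O : idomainType) (K : fieldType)
    (iota : {rmorphism {fraction O} -> K}) (n : nat) : set {mps K[n]} :=
  \bigcup_(c in [set: K]) \bigcup_(f in [set f : O | f != 0])
    adjoin (mps_over (iota @` localization f)) c%:A.

End Families.

(* Main.v *)
(** The Eisenstein series over O are the series with coefficients in one of the
    rings B = O_f[c] with c integral over O_f. These subrings of K form a
    directed family covering K (primitive element theorem), and everything but
    the uncountability condition (b) holds for the series over any such family:
    Weierstrass division only needs the inverse of one coefficient.

    For (c), reduce p_k modulo Gamma to q_k of degree < d in z. If q_k(t, g(t))
    has its coefficients in B, then q_k has its coefficients in B, for a B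
    independent of k: otherwise one gets, over the residue field at a maximal
    ideal of B, a relation of degree < d between t and g. By Gauss' lemma there
    is one whose degree in t is at most that of Gamma, and this finite linear
    system was made regular over B by putting a left inverse of it in B.

    For (b), take l in the uncountable field k. By pigeonhole the coefficients
    of F(x', l x_1) lie, for infinitely many l, in a fixed finite-dimensional
    space over Frac(O), and then, O being a UFD, have denominators dividing the
    powers of a fixed element. As the differences of elements of k are units,
    interpolation yields the same for the coefficients of F. *)
Require Import Defs.
From HB Require Import structures.
From mathcomp Require Import all_boot all_order all_algebra all_fingroup.
From mathcomp Require Import boolp classical_sets cardinality.
From mathcomp Require Import mpoly.
From mathcomp Require Import generic_quotient ring_quotient fraction polyXY
  separable mxpoly.

Set Implicit Arguments.
Unset Strict Implicit.
Unset Printing Implicit Defensive.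

Import GRing.Theory.
Local Open Scope ring_scope.
Local Open Scope classical_set_scope.

(** * Power series with coefficients in a subring *)

(** In every condition but (b), directedness puts finitely many auxiliary constants in one B; it
    never provides infinitely many. This shapes (c): the degree of q_k in t grows with k, so the
    linear systems that recover the q_k from their values at g are infinitely many, and directedness
    yields no B containing left inverses of all of them. Residue fields reduce the question to the
    single system whose size is that of Gamma.

    In (b) two quantities depend on l without a bound: the space spanned by the coefficients and
    their denominators. They call for separate pigeonhole arguments, the second one carried out
    coordinate by coordinate in a basis of the space that the first one provides. *)

Record subring_set (R : pzRingType) (B : set R) : Prop := {
  subring_set1 : B 1;
  subring_setB : forall x y, B x -> B y -> B (x - y);
  subring_setM : forall x y, B x -> B y -> B (x * y)
}.

Section SubringSet.
Variables (R : comNzRingType) (B : set R).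
Hypothesis subB : subring_set B.

Lemma subring_set0 : B 0.
Proof.
by have b1 := subring_set1 subB; rewrite -(subrr 1); apply: subring_setB.
Qed.

Lemma subring_setN x : B x -> B (- x).
Proof.
by move=> Bx; rewrite -sub0r; apply: subring_setB => //; apply: subring_set0.
Qed.

Lemma subring_setD x y : B x -> B y -> B (x + y).
Proof.
by move=> Bx /subring_setN By; rewrite -[y]opprK; apply: subring_setB.
Qed.

Lemma subring_set_sum I (r : seq I) (P : pred I) F :
  (forall i, P i -> B (F i)) -> B (\sum_(i <- r | P i) F i).
Proof. by apply: big_ind => //; [apply: subring_set0|apply: subring_setD]. Qed.

Lemma subring_set_prod I (r : seq I) (P : pred I) F :
  (forall i, P i -> B (F i)) -> B (\prod_(i <- r | P i) F i).
Proof.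
by apply: big_ind => //; [apply: subring_set1|apply: subring_setM].
Qed.

Lemma subring_setX x n : B x -> B (x ^+ n).
Proof.
move=> Bx; elim: n => [|n IHn]; first exact: subring_set1.
by rewrite exprS; apply: subring_setM.
Qed.

Lemma subring_set_horner (p : {poly R}) x :
  (forall i, B p`_i) -> B x -> B p.[x].
Proof.
move=> Bp Bx; rewrite horner_coef; apply: subring_set_sum => i _.
by apply: subring_setM => //; apply: subring_setX.
Qed.

End SubringSet.

Section MpsTheory.
Variables (n : nat) (R : comNzRingType).
Implicit Types (f g h : {mps R[n]}) (m u : 'X_{1..n}).

Lemma mps_coef0 m : (0 : {mps R[n]}) m = 0.
Proof. exact: mcoeff0. Qed.

Lemma mps_coef1 m : (1 : {mps R[n]}) m = (m == 0%MM)%:R.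
Proof. exact: mcoeff1. Qed.

Lemma mps_coefD f g m : (f + g) m = f m + g m. Proof. by []. Qed.

Lemma mps_coefB f g m : (f - g) m = f m - g m. Proof. by []. Qed.

Lemma mps_coefZ c f m : (c *: f) m = c * f m. Proof. by []. Qed.

Lemma mps_coefM f g m :
  (f * g) m = \sum_(k : 'X_{1..n < (mdeg m).+1, (mdeg m).+1}
                       | m == (k.1 + k.2)%MM) f k.1 * g k.2.
Proof. by []. Qed.

Lemma mps_coef_sum I (r : seq I) (P : pred I) (F : I -> {mps R[n]}) m :
  (\sum_(i <- r | P i) F i) m = \sum_(i <- r | P i) F i m.
Proof.
by apply: (big_morph (fun f : {mps R[n]} => f m)) => //; apply: mps_coef0.
Qed.

Lemma mps_of_mpolyM : {morph @mps_of_mpoly n R : p q / p * q}.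
Proof.
by move=> p q; apply: mpsP => m; rewrite (@mps_mul_mpoly _ _ (mdeg m).+1
  _ _ p q).
Qed.

Lemma mps_of_mpolyXn (p : {mpoly R[n]}) k :
  mps_of_mpoly (p ^+ k) = mps_of_mpoly p ^+ k.
Proof. by elim: k => [//|k IHk]; rewrite !exprS mps_of_mpolyM IHk. Qed.

Definition mpsXm m : {mps R[n]} := mps_of_mpoly 'X_[m].

Lemma mps_coefXm u m : mpsXm u m = (u == m)%:R.
Proof. exact: mcoeffX. Qed.

Lemma mpsXmD u v : mpsXm (u + v) = mpsXm u * mpsXm v.
Proof. by rewrite /mpsXm mpolyXD mps_of_mpolyM. Qed.

Lemma mpsXmMn u k : mpsXm (u *+ k)%MM = mpsXm u ^+ k.
Proof. by rewrite /mpsXm -mpolyXn mps_of_mpolyXn. Qed.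

Lemma mpsXm_sum I (r : seq I) (P : pred I) (F : I -> 'X_{1..n}) :
  mpsXm (\sum_(i <- r | P i) F i)%MM = \prod_(i <- r | P i) mpsXm (F i).
Proof.
by apply: (big_morph _ mpsXmD); rewrite /mpsXm mpolyX0.
Qed.

Lemma mps_coefXmM u f m :
  (mpsXm u * f) m = if (u <= m)%MM then f (m - u)%MM else 0.
Proof.
rewrite (@mps_mul_mpoly _ _ (mdeg m).+1 _ _ 'X_[u] (mps_trunc (mdeg m).+1 f))//;
  last exact: mps_truncE.
rewrite mulrC; case: ifPn => [le_um|nle_um].
  rewrite -{1}(submK le_um) addmC mcoeffMX mps_truncE //.
  by rewrite ltnS mdegB.
rewrite mcoeffM big1 // => -[k1 k2] /= /eqP em.
rewrite mcoeffX; case: eqP => [eu|]; last by rewrite mulr0.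
by case/negP: nle_um; apply/mnm_lepP => i; rewrite em eu mnmDE leq_addl.
Qed.

Lemma mps_mull_ext f g h m :
    (forall u v, (u + v)%MM = m -> f u * g v = f u * h v) ->
  (f * g) m = (f * h) m.
Proof.
by move=> H; apply: eq_bigr => -[k1 k2] /= /eqP/esym em; apply: H.
Qed.

Lemma mps_scalerE (c : R) f : c%:A * f = c *: f.
Proof. by rewrite -scalerAl mul1r. Qed.

Lemma mps_algX (c : R) k : (c%:A : {mps R[n]}) ^+ k = (c ^+ k)%:A.
Proof. by rewrite exprZn expr1n. Qed.

Lemma mps_over_subring (B : set R) :
  subring_set B -> subring_set (@mps_over n R B).
Proof.
move=> sB; split=> [m|f g Bf Bg m|f g Bf Bg m].
- rewrite mps_coef1; case: eqP => _; last exact: subring_set0.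
  exact: subring_set1.
- by rewrite mps_coefB; apply: (subring_setB sB).
by apply: subring_set_sum => // k _; apply: (subring_setM sB).
Qed.

Lemma mps_over_Xm (B : set R) u : subring_set B -> mps_over B (mpsXm u).
Proof.
move=> sB m; rewrite mps_coefXm; case: eqP => _; last exact: subring_set0.
exact: subring_set1.
Qed.

Lemma mps_over_scale (B : set R) c f :
  subring_set B -> B c -> mps_over B f -> mps_over B (c *: f).
Proof. by move=> sB Bc Bf m; apply: (subring_setM sB). Qed.

End MpsTheory.

Arguments mpsXm {n} R m.

(** * Substitution of monomials for the variables *)

Section Subst.
Variables (R : comNzRingType) (n p : nat).
Implicit Types (f : {mps R[n]}) (k : 'X_{1..n}) (m : 'X_{1..p}).

Lemma mps_subst_over (B : set R) (g : 'I_n -> {mps R[p]}) f : subring_set B ->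
  (forall i, mps_over B (g i)) -> mps_over B f -> mps_over B (mps_subst g f).
Proof.
move=> sB Bg Bf m; have sBp := mps_over_subring p sB.
apply: subring_set_sum => // k _; apply: (subring_setM sB) => //.
by apply: (subring_set_prod sBp) => i _; apply: (subring_setX sBp).
Qed.

Lemma mps_subst0 (g : 'I_n -> {mps R[p]}) : mps_subst g 0 = 0.
Proof.
by apply: mpsP => m; rewrite mps_coef0 /= big1 // => k _; rewrite mcoeff0 mul0r.
Qed.

Variables (u : 'I_n -> 'X_{1..p}).

(** Substituting c_i x^(u_i) for x_i sends x^k to a constant times x^([mnm_image] k). The
    substitutions in (a), (b) and in Weierstrass division all have this shape and reduce to a linear
    map on exponents. *)
Definition mnm_image k : 'X_{1..p} := (\sum_(i < n) u i *+ k i)%MM.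

Variables (c : 'I_n -> R) (g : 'I_n -> {mps R[p]}).
Hypothesis gE : forall i, g i = c i *: mpsXm R (u i).

Lemma mps_subst_monomial f m :
  mps_subst g f m = \sum_(k : 'X_{1..n < (mdeg m).+1} | mnm_image k == m)
                      f k * \prod_(i < n) c i ^+ k i.
Proof.
rewrite /= [RHS]big_mkcond; apply: eq_bigr => k _.
under eq_bigr do rewrite gE exprZn -mpsXmMn.
rewrite scaler_prod mps_coefZ -mpsXm_sum.
rewrite mps_coefXm /mnm_image; case: eqP => _; first by rewrite mulr1.
by rewrite !mulr0.
Qed.

Lemma mps_subst_notin f m :
  (forall k, mnm_image k <> m) -> mps_subst g f m = 0.
Proof.
by move=> H; rewrite mps_subst_monomial big1 // => k /eqP /H.
Qed.

(** The degree condition says that k belongs to the truncated sum defining the substitution.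
    Competing exponents are excluded only where their factor is nonzero, which covers the
    substitution of 0 for a variable. *)
Lemma mps_subst_unique f k : (mdeg k <= mdeg (mnm_image k))%N ->
    (forall k', mnm_image k' = mnm_image k ->
       f k' * \prod_(i < n) c i ^+ k' i != 0 -> k' = k) ->
  mps_subst g f (mnm_image k) = f k * \prod_(i < n) c i ^+ k i.
Proof.
rewrite -ltnS => lt_k inj_k; rewrite mps_subst_monomial.
rewrite (bigD1 (BMultinom lt_k)) //= [X in _ + X]big1 ?addr0 // =>
  k' /andP[/eqP /inj_k H nk].
by apply/eqP; apply: contraNT nk => /H/eqP ek; rewrite -val_eqE.
Qed.

End Subst.

Section MonomialImage.
Variables (n p : nat) (u : 'I_n -> 'X_{1..p}).

Lemma mnm_imageE k j : mnm_image u k j = (\sum_(i < n) u i j * k i)%N.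
Proof. by rewrite mnm_sumE; apply: eq_bigr => i _; rewrite mulmnE. Qed.

Lemma leq_mdeg_image k :
  (forall i, 0 < mdeg (u i))%N -> (mdeg k <= mdeg (mnm_image u k))%N.
Proof.
move=> u_gt0; rewrite /mnm_image mdeg_sum mdegE; apply: leq_sum => i _.
by rewrite mdegMn leq_pmull.
Qed.

End MonomialImage.

Section VariableImage.
Variables (n p : nat) (h : 'I_n -> 'I_p).
Hypothesis h_inj : injective h.

Lemma mnm_imageU k i : mnm_image (fun i => U_(h i)%MM) k (h i) = k i.
Proof.
rewrite mnm_imageE (bigD1 i) //= mnm1E eqxx mul1n big1 ?addn0 // => j ji.
by rewrite mnm1E (inj_eq h_inj) (negPf ji).
Qed.

Lemma mnm_imageU_out k j : (forall i, h i != j) ->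
  mnm_image (fun i => U_(h i)%MM) k j = 0%N.
Proof.
by move=> H; rewrite mnm_imageE big1 // => i _; rewrite mnm1E (negPf (H i)).
Qed.

Lemma mnm_imageU_inj : injective (mnm_image (fun i => U_(h i)%MM)).
Proof. by move=> k k' e; apply/mnmP => i; rewrite -!mnm_imageU e. Qed.

Variable R : comNzRingType.

Lemma mps_substU_coef (f : {mps R[n]}) k :
  mps_subst (fun i => mpsX R (h i)) f (mnm_image (fun i => U_(h i)%MM) k) = f k.
Proof.
rewrite (@mps_subst_unique _ _ _ _ (fun=> 1)).
- by rewrite big1 ?mulr1 // => i _; rewrite expr1n.
- by move=> i; rewrite scale1r.
- by apply: leq_mdeg_image => i; rewrite mdeg1.
by move=> k' /mnm_imageU_inj.
Qed.

Lemma mps_substU_notin (f : {mps R[n]}) m :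
    (forall k, mnm_image (fun i => U_(h i)%MM) k <> m) ->
  mps_subst (fun i => mpsX R (h i)) f m = 0.
Proof.
by apply: (@mps_subst_notin _ _ _ _ (fun=> 1)) => i; rewrite scale1r.
Qed.

Lemma mps_substU_over (B : set R) (f : {mps R[n]}) : subring_set B ->
  mps_over B (mps_subst (fun i => mpsX R (h i)) f) <-> mps_over B f.
Proof.
move=> sB; split=> [Bf k|]; first by rewrite -mps_substU_coef.
by apply: mps_subst_over => // i; apply: mps_over_Xm.
Qed.

End VariableImage.

(** * Weierstrass division *)

Section Contraction.
Variables (n : nat) (R : comNzRingType) (w : 'X_{1..n} -> nat).
Variable Phi : {mps R[n]} -> {mps R[n]}.
Hypothesis Phi_contr : forall (f g : {mps R[n]}) m,
  (forall b, (w b < w m)%N -> f b = g b) -> Phi f m = Phi g m.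

(** The coefficient at m of the iterates of [Phi] at 0 is stationary from step w m + 1 on. The
    weight may take one value on infinitely many exponents, as the degree in x' does in Weierstrass
    division. *)
Definition mps_fix : {mps R[n]} := MPS (fun m => iter (w m).+1 Phi 0 m).

Lemma mps_iter_stable i j m :
  (w m < i)%N -> (w m < j)%N -> iter i Phi 0 m = iter j Phi 0 m.
Proof.
elim: i j m => [|i IHi] [|j] m //; rewrite !ltnS => wi wj.
by apply: Phi_contr => b wb; apply: IHi; apply: leq_trans wb _.
Qed.

Lemma mps_fixE : Phi mps_fix = mps_fix.
Proof.
apply: mpsP => m; apply: Phi_contr => b wb.
by apply: mps_iter_stable.
Qed.

Lemma mps_fix_unique f g : Phi f = f -> Phi g = g -> f = g.
Proof.
move=> ef eg; apply: mpsP => m; have [r] := ubnP (w m).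
elim: r m => // r IHr m; rewrite ltnS => wm.
rewrite -ef -eg; apply: Phi_contr => b wb; apply: IHr.
exact: leq_trans wb wm.
Qed.

Lemma mps_fix_over (B : set R) : B 0 ->
  (forall f, mps_over B f -> mps_over B (Phi f)) -> mps_over B mps_fix.
Proof.
move=> B0 BPhi m /=; have: forall i, mps_over B (iter i Phi 0).
  by elim=> [|i IHi] /=; [move=> k; rewrite mps_coef0|apply: BPhi].
by move=> Biter; apply: (Biter (w m).+1).
Qed.

End Contraction.

Lemma mps_inverse n (K : fieldType) (B : set K) (f : {mps K[n]}) :
    subring_set B -> mps_over B f -> f 0%MM != 0 -> B (f 0%MM)^-1 ->
  exists2 g, mps_over B g & f * g = 1.
Proof.
move=> sB Bf f0 Ba; set a := _^-1 in Ba.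
(* A fixed point satisfies a f g = a. Since a f - 1 has no constant term, the map is contracting for
   the total degree. *)
pose Phi g := a%:A - (a *: f - 1) * g.
have sBn := mps_over_subring n sB.
have Phi_contr (g h : {mps K[n]}) m :
    (forall b, (mdeg b < mdeg m)%N -> g b = h b) -> Phi g m = Phi h m.
  move=> egh; rewrite !mps_coefB; congr (_ - _); apply: mps_mull_ext => u v em.
  have [->|u_neq0] := eqVneq u 0%MM.
    by rewrite mps_coefB mps_coefZ mps_coef1 eqxx mulVf // subrr !mul0r.
  rewrite egh // -em mdegD -[ltnLHS]add0n ltn_add2r lt0n.
  by rewrite mdeg_eq0.
exists (mps_fix (@mdeg n) Phi).
  apply: mps_fix_over; first exact: subring_set0.
  move=> g Bg; apply: (subring_setB sBn).
    by apply: mps_over_scale => //; apply: subring_set1.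
  apply: (subring_setM sBn) => //; apply: (subring_setB sBn).
    exact: mps_over_scale.
  exact: subring_set1.
have := mps_fixE Phi_contr; set g := mps_fix _ _ => /eqP.
rewrite /Phi mulrBl mul1r opprB addrA subr_eq [a%:A + g]addrC => /eqP/addrI.
rewrite -scalerAl => /(congr1 (fun h => f 0%MM *: h)).
by rewrite !scalerA divff // !scale1r.
Qed.

Section LastVariable.
Variable n : nat.
Implicit Types (m u v : 'X_{1..n.+1}) (a : 'X_{1..n}).

Definition mnm_ext a i : 'X_{1..n.+1} :=
  [multinom (if unlift ord_max j is Some j' then a j' else i) | j < n.+1].

Definition mnm_init m : 'X_{1..n} := [multinom m (lift ord_max j) | j < n].

Definition mnm_last i : 'X_{1..n.+1} := (U_(ord_max) *+ i)%MM.

Lemma mnm_initE m j : mnm_init m j = m (lift ord_max j).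
Proof. exact: mnmE. Qed.

Lemma mnm_ext_max a i : mnm_ext a i ord_max = i.
Proof. by rewrite mnmE unlift_none. Qed.

Lemma mnm_ext_lift a i j : mnm_ext a i (lift ord_max j) = a j.
Proof. by rewrite mnmE liftK. Qed.

Lemma mnm_initK m : mnm_ext (mnm_init m) (m ord_max) = m.
Proof.
apply/mnmP => j; rewrite mnmE; case: unliftP => [j' ->|-> //].
by rewrite mnmE.
Qed.

Lemma mnm_extK a i : mnm_init (mnm_ext a i) = a.
Proof. by apply/mnmP => j; rewrite mnmE mnm_ext_lift. Qed.

Lemma mnm_initD u v : mnm_init (u + v)%MM = (mnm_init u + mnm_init v)%MM.
Proof. by apply/mnmP => j; rewrite mnmE !mnmDE !mnmE. Qed.

Lemma mnm_last_max i : mnm_last i ord_max = i.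
Proof. by rewrite mulmnE mnm1E eqxx mul1n. Qed.

Lemma mnm_last_lift i j : mnm_last i (lift ord_max j) = 0%N.
Proof. by rewrite mulmnE mnm1E (negPf (neq_lift _ _)). Qed.

Lemma mnm_init_last i : mnm_init (mnm_last i) = 0%MM.
Proof. by apply/mnmP => j; rewrite mnmE mnm_last_lift mnm0E. Qed.

Lemma mnm_ext0 i : mnm_ext 0 i = mnm_last i.
Proof.
by rewrite -(mnm_init_last i) -[in RHS](mnm_initK (mnm_last i)) mnm_last_max.
Qed.

Lemma mnm_last_le d m : (mnm_last d <= m)%MM = (d <= m ord_max)%N.
Proof.
apply/mnm_lepP/idP => [/(_ ord_max)|le_dm j]; first by rewrite mnm_last_max.
case: (unliftP ord_max j) => [j' ->|->]; first by rewrite mnm_last_lift.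
by rewrite mnm_last_max.
Qed.

Variable R : comNzRingType.
Implicit Types (f g : {mps R[n.+1]}).

Definition mps_slice i f : {mps R[n]} := MPS (fun a => f (mnm_ext a i)).

Definition mps_high d f : {mps R[n.+1]} := MPS (fun m => f (m + mnm_last d)%MM).

Definition mps_low d f : {mps R[n.+1]} :=
  MPS (fun m => if (m ord_max < d)%N then f m else 0).

Lemma mps_low_high d f : f = mps_low d f + mpsXm R (mnm_last d) * mps_high d f.
Proof.
apply: mpsP => m; rewrite mps_coefD mps_coefXmM mnm_last_le /= ltnNge.
case: leqP => [le_dm|_]; last by rewrite addr0.
by rewrite add0r submK // mnm_last_le.
Qed.

Lemma mps_highD d f g : mps_high d (f + g) = mps_high d f + mps_high d g.
Proof. exact: mpsP. Qed.

Lemma mps_highXm d f : mps_high d (mpsXm R (mnm_last d) * f) = f.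
Proof.
apply: mpsP => m; rewrite [LHS]mps_coefXmM mnm_last_le mnmDE mnm_last_max.
by rewrite leq_addl addmK.
Qed.

Lemma mps_subst_lift (f : {mps R[n]}) m :
  mps_subst (@mpsX' R n) f m = if m ord_max == 0%N then f (mnm_init m) else 0.
Proof.
have lift_inj' : injective (lift (@ord_max n)) := @lift_inj _ _.
have imE a : mnm_image (fun i => U_(lift ord_max i)%MM) a = mnm_ext a 0.
  apply/mnmP => j; case: (unliftP ord_max j) => [j' ->|->].
    by rewrite mnm_imageU // mnm_ext_lift.
  rewrite mnm_ext_max mnm_imageU_out // => i.
  by rewrite eq_sym neq_lift.
case: eqP => [m0|nm0].
  by rewrite -{1}[m]mnm_initK m0 -imE mps_substU_coef.
by apply: mps_substU_notin => // a; rewrite imE => em;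
  rewrite -em mnm_ext_max in nm0.
Qed.

Lemma mps_of_poly_coef (P : {poly {mps R[n]}}) m :
  mps_of_poly P m = P`_(m ord_max) (mnm_init m).
Proof.
rewrite /mps_of_poly; set Q := map_poly _ _.
have QE i : Q`_i = mps_subst (@mpsX' R n) P`_i.
  by rewrite coef_map_id0 // mps_subst0.
rewrite (@horner_coef_wide _ (maxn (size Q) (m ord_max).+1)) ?leq_maxl //.
have lt_m : (m ord_max < maxn (size Q) (m ord_max).+1)%N by rewrite leq_maxr.
have coefE i : (Q`_i * mpsX R ord_max ^+ i) m =
    if (i <= m ord_max)%N then Q`_i (m - mnm_last i)%MM else 0.
  by rewrite mulrC -mpsXmMn mps_coefXmM mnm_last_le.
rewrite mps_coef_sum; under eq_bigr do rewrite coefE.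
rewrite (bigD1 (Ordinal lt_m)) //= leqnn [X in _ + X]big1 => [|i /eqP ni].
  rewrite addr0 QE mps_subst_lift mnmBE mnm_last_max subnn eqxx.
  by congr (_ _ _); apply/mnmP => j; rewrite !mnm_initE mnmBE mnm_last_lift
    subn0.
case: leqP => // le_im; rewrite QE mps_subst_lift mnmBE.
rewrite mnm_last_max subn_eq0; case: leqP => // le_mi; case: ni.
by apply: val_inj; apply/eqP; rewrite eqn_leq le_im.
Qed.

Lemma mps_of_poly_inj : injective (@mps_of_poly R n).
Proof.
move=> P Q ePQ; apply/polyP => i; apply: mpsP => a.
by have := mps_of_poly_coef P (mnm_ext a i);
  rewrite ePQ mps_of_poly_coef mnm_ext_max mnm_extK.
Qed.

Lemma mps_high_of_poly d (P : {poly {mps R[n]}}) :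
  (size P <= d)%N -> mps_high d (mps_of_poly P) = 0.
Proof.
move=> sP; apply: mpsP => m; rewrite mps_coef0 /= mps_of_poly_coef nth_default.
  exact: mps_coef0.
by rewrite mnmDE mnm_last_max; apply: leq_trans sP (leq_addl _ _).
Qed.

Lemma mps_of_poly_slice d f : mps_high d f = 0 ->
  mps_of_poly (\poly_(i < d) mps_slice i f) = f.
Proof.
move=> f0; apply: mpsP => m; rewrite mps_of_poly_coef coef_poly.
case: leqP => [le_dm|_] /=; last by rewrite mnm_initK.
rewrite mcoeff0 -{1}[m](@submK _ (mnm_last d) m); last by rewrite mnm_last_le.
by have /(congr1 (fun g : {mps R[n.+1]} => g (m - mnm_last d)%MM)) := f0;
  rewrite mps_coef0.
Qed.

End LastVariable.

(* Writing F = F_low + x_n^d U and Z = U Q, the equation G = F Q + R says that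
   Z = high(G) - high(F_low U^-1 Z); as F_low U^-1 lies in (x_1, ..., x_{n-1}),
   the right-hand side is contracting for the degree in these variables. *)
Section WeierstrassDivision.
Variables (n d : nat) (R : comNzRingType) (F V : {mps R[n.+1]}).
Implicit Types (G Q : {mps R[n.+1]}) (P : {poly {mps R[n]}}).
Hypothesis F_lt : forall l, (l < d)%N -> F (mnm_last n l) = 0.
Hypothesis UV : mps_high d F * V = 1.

Definition wdiv_map (G Z : {mps R[n.+1]}) : {mps R[n.+1]} :=
  mps_high d G - mps_high d (mps_low d F * V * Z).

Lemma mps_low_init0 m : mnm_init m = 0%MM -> mps_low d F m = 0.
Proof.
move=> m0 /=; case: leqP => // lt_md.
by rewrite -[m]mnm_initK m0 mnm_ext0 F_lt.
Qed.

Lemma wdiv_map_contr G (f g : {mps R[n.+1]}) m :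
    (forall b, (mdeg (mnm_init b) < mdeg (mnm_init m))%N -> f b = g b) ->
  wdiv_map G f m = wdiv_map G g m.
Proof.
move=> efg; rewrite !mps_coefB; congr (_ - _); apply: mps_mull_ext => u v em.
have [u0|u_neq0] := eqVneq (mnm_init u) 0%MM.
  suff ->: (mps_low d F * V) u = 0 by rewrite !mul0r.
  (* An exponent free of x' splits only into exponents free of x', at which the low part vanishes
     because F(0, x_n) is divisible by x_n^d. *)
  apply: big1 => -[k1 k2] /= /eqP eu; rewrite -[if _ then _ else _]/(mps_low d
    F k1).
  have [k10 _] : mnm_init k1 = 0%MM /\ mnm_init k2 = 0%MM.
    have := congr1 (@mnm_init n) eu; rewrite u0 mnm_initD => /esym/eqP.
    by rewrite mnmD_eq0 => /andP[/eqP-> /eqP->].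
  by rewrite mps_low_init0 ?mul0r.
congr (_ * _); apply: efg; have /(congr1 (@mnm_init n)) := em.
rewrite !mnm_initD mnm_init_last addm0 => <-.
by rewrite mdegD -[ltnLHS]add0n ltn_add2r lt0n mdeg_eq0.
Qed.

Lemma wdiv_map_quotient G Q P : (size P <= d)%N ->
    G = F * Q + mps_of_poly P ->
  wdiv_map G (mps_high d F * Q) = mps_high d F * Q.
Proof.
move=> sP eG; rewrite /wdiv_map {1}eG mps_highD mps_high_of_poly // addr0.
rewrite {1}(mps_low_high d F) mulrDl mps_highD -mulrA mps_highXm.
rewrite (_ : mps_low d F * V * _ = mps_low d F * Q);
  first by rewrite addrAC subrr add0r.
by rewrite -!mulrA (mulrA V) (mulrC V) UV mul1r.
Qed.

Lemma wdiv_unique G Q P Q' P' : (size P <= d)%N -> (size P' <= d)%N ->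
    G = F * Q + mps_of_poly P -> G = F * Q' + mps_of_poly P' ->
  Q = Q' /\ P = P'.
Proof.
move=> sP sP' eG eG'.
have eQ : Q = Q'.
  have := mps_fix_unique (@wdiv_map_contr G) (wdiv_map_quotient sP eG)
            (wdiv_map_quotient sP' eG').
  move=> /(congr1 (fun f => V * f)).
  by rewrite !mulrA ![V * _]mulrC UV !mul1r.
split=> //; apply: mps_of_poly_inj; apply: (addrI (F * Q)).
by rewrite -eG {1}eQ -eG'.
Qed.

Lemma wdiv_exists (B : set R) G : subring_set B ->
    mps_over B F -> mps_over B V -> mps_over B G ->
  exists Q P, [/\ mps_over B Q, forall i, mps_over B P`_i, (size P <= d)%N
                & G = F * Q + mps_of_poly P].
Proof.
move=> sB BF BV BG; have sBn := mps_over_subring n.+1 sB.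
have Bhigh f : mps_over B f -> mps_over B (mps_high d f) by move=> Bf m;
  apply: Bf.
(* Z plays the role of U Q, so the quotient is V Z. The fixed-point equation says exactly that the
   remainder G - F V Z has no term of degree d or more in x_n. *)
pose Z := mps_fix (fun m => mdeg (mnm_init m)) (wdiv_map G).
have ZE : wdiv_map G Z = Z by apply: mps_fixE; apply: wdiv_map_contr.
have BZ : mps_over B Z.
  apply: mps_fix_over => [|f Bf]; first exact: subring_set0.
  apply: (subring_setB sBn); apply: Bhigh => //.
  apply: (subring_setM sBn) => //; apply: (subring_setM sBn) => // m /=.
  by case: ifP => _; [apply: BF|apply: subring_set0].
pose H := G - F * (V * Z).
have BH : mps_over B H.
  by apply: (subring_setB sBn) => //; do 2!apply: (subring_setM sBn) => //.
have H0 : mps_high d H = 0.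
  have -> : mps_high d H = mps_high d G - mps_high d (F * (V * Z)) by apply:
    mpsP.
  rewrite {1}(mps_low_high d F) mulrDl mps_highD -mulrA mps_highXm.
  rewrite [mps_high d F * _]mulrA UV mul1r mulrA opprD addrA.
  by rewrite -/(wdiv_map G Z) ZE subrr.
exists (V * Z), (\poly_(i < d) mps_slice i H); split.
- exact: (subring_setM sBn).
- move=> i; rewrite coef_poly; case: ifP => _ a; first exact: BH.
  by rewrite mps_coef0; apply: subring_set0.
- exact: size_poly.
by rewrite mps_of_poly_slice // addrC subrK.
Qed.

End WeierstrassDivision.

(** * Directed families of subrings *)

Record directed_subrings (R : comNzRingType) (D : set (set R)) : Prop := {
  directed_subring : forall B, D B -> subring_set B;
  directed_join : forall B1 B2, D B1 -> D B2 ->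
    exists B, [/\ D B, B1 `<=` B & B2 `<=` B];
  directed_cover : forall x, exists2 B, D B & B x
}.

Definition directed_series (R : comNzRingType) (D : set (set R)) n :
  set {mps R[n]} := [set f | exists2 B, D B & mps_over B f].

Section DirectedSeries.
Variables (K : fieldType) (D : set (set K)).
Hypothesis dirD : directed_subrings D.
Local Notation A := (directed_series D).

(** The device that puts the constants needed by an argument (an inverse, the entries of a matrix,
    the coefficients of a polynomial) in a ring of the family. *)
Lemma directed_seq B0 (s : seq K) : D B0 ->
  exists B, [/\ D B, B0 `<=` B & {in s, forall x, B x}].
Proof.
move=> DB0; elim: s => [|x s [B1 [DB1 le01 B1s]]]; first by exists B0;
  split=> // x.
have [B2 DB2 B2x] := directed_cover dirD x.
have [B [DB le1 le2]] := directed_join dirD DB1 DB2.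
exists B; split=> // [y /le01/le1 //|y].
by rewrite inE => /predU1P[->|/B1s/le1 //]; apply: le2.
Qed.

Lemma directed_inhabited : exists B, D B.
Proof. by have [B DB _] := directed_cover dirD 0; exists B. Qed.

Lemma directed_series2 n p (f : {mps K[n]}) (g : {mps K[p]}) : A f -> A g ->
  exists B, [/\ D B, mps_over B f & mps_over B g].
Proof.
move=> [B1 DB1 B1f] [B2 DB2 B2g].
have [B [DB le1 le2]] := directed_join dirD DB1 DB2.
by exists B; split=> // m; [apply/le1/B1f|apply/le2/B2g].
Qed.

Lemma directed_series_subalg n : GRing.subalg_closed (mem (@A n)).
Proof.
split.
- have [B DB] := directed_inhabited; rewrite inE; exists B => //.
  exact: subring_set1 (mps_over_subring n (directed_subring dirD DB)).
- move=> a f g; rewrite !inE => Af Ag.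
  have [B1 [DB1 B1f B1g]] := directed_series2 Af Ag.
  have [B [DB le1 Ba]] := directed_seq [:: a] DB1.
  have sB := directed_subring dirD DB.
  exists B => //; apply: (subring_setD (mps_over_subring n sB)).
    apply: mps_over_scale => //; first by apply: Ba; rewrite inE.
    by move=> m; apply/le1/B1f.
  by move=> m; apply/le1/B1g.
move=> f g; rewrite !inE => Af Ag.
have [B [DB Bf Bg]] := directed_series2 Af Ag; exists B => //.
exact: (subring_setM (mps_over_subring n (directed_subring dirD DB))).
Qed.

Lemma directed_series_poly n (p : {mpoly K[n]}) : A (mps_of_mpoly p).
Proof.
have [B0 DB0] := directed_inhabited.
have [B [DB _ Bs]] := directed_seq [seq p@_m | m <- msupp p] DB0.
exists B => // m /=; have [pm|pm] := boolP (m \in msupp p).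
  exact/Bs/map_f.
by rewrite memN_msupp_eq0 //; apply: subring_set0 (directed_subring dirD DB).
Qed.

Lemma directed_series_substU n p (h : 'I_n -> 'I_p) (f : {mps K[n]}) :
    injective h ->
  A (mps_subst (fun i => mpsX K (h i)) f) <-> A f.
Proof.
move=> h_inj.
have substE B := fun DB : D B => mps_substU_over h_inj f (directed_subring dirD
  DB).
by split=> -[B DB Bf]; exists B => //; apply/(substE B DB).
Qed.

Lemma directed_series_unit n (f : {mps K[n]}) :
  A f -> f 0%MM != 0 -> exists2 g, A g & f * g = 1.
Proof.
move=> [B1 DB1 B1f] f0.
have [B [DB le1 Ba]] := directed_seq [:: (f 0%MM)^-1] DB1.
have [] := @mps_inverse _ _ B f (directed_subring dirD DB).
- by move=> m; apply/le1/B1f.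
- exact: f0.
- by apply: Ba; rewrite inE.
by move=> g Bg fg; exists g => //; exists B.
Qed.

Lemma mps_subst_last_coef n (F : {mps K[n.+1]}) l :
  mps_subst (tuple_last (fun _ : 'I_n => 0) (mpsX K (@ord0 0))) F
    (U_(ord0) *+ l)%MM = F (mnm_last n l).
Proof.
(* F(0, x_n) as a monomial substitution: every variable is sent to the same monomial, with
   coefficient 0 except for the last one. *)
pose c (i : 'I_n.+1) : K := (i == ord_max)%:R.
have imE k : mnm_image (fun=> U_(@ord0 0))%MM k = (U_(ord0) *+ mdeg k)%MM.
  by apply/mnmP => i; rewrite mnm_imageE mulmnE mdegE big_distrr.
have degl : mdeg (mnm_last n l) = l by rewrite mdegMn mdeg1 mul1n.
rewrite -[in LHS]degl -imE (@mps_subst_unique _ _ _ _ c).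
- rewrite big1 ?mulr1 // => i _; rewrite /c; case: eqP => [_|];
  first by rewrite expr1n.
  case: (unliftP ord_max i) => [j -> _|-> //].
  by rewrite mnm_last_lift.
- move=> i; rewrite /c /tuple_last; case: unliftP => [j ->|->].
    by rewrite eq_sym (negPf (neq_lift _ _)) scale0r.
  by rewrite eqxx scale1r.
- by apply: leq_mdeg_image => i; rewrite mdeg1.
move=> k; rewrite !imE => /(congr1 (@mdeg _));
  rewrite !mdegMn !mdeg1 !mul1n => ek.
rewrite mulf_eq0 negb_or => /andP[_ /prodf_neq0 nz].
have k0 (j : 'I_n) : k (lift ord_max j) = 0%N.
  have := nz (lift ord_max j) isT; rewrite /c [lift _ _ == _]eq_sym (negPf
    (neq_lift _ _)).
  by rewrite expf_eq0 eqxx andbT lt0n negbK => /eqP.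
rewrite -[k]mnm_initK -mnm_ext0; congr mnm_ext.
  by apply/mnmP => j; rewrite mnm_initE k0 mnm0E.
move: ek; rewrite mdegE (bigD1 ord_max) //= big1 ?addn0 // => i.
by case: (unliftP ord_max i) => [j -> _|->]; rewrite ?eqxx // k0.
Qed.

Lemma directed_series_division n d (F : {mps K[n.+1]}) (u : {mps K[1]}) :
    A F -> mps_subst (tuple_last (fun _ : 'I_n => 0) (mpsX K ord0)) F
             = mpsX K ord0 ^+ d * u ->
    u 0%MM != 0 -> forall G, A G ->
  exists! QP : {mps K[n.+1]} * {poly {mps K[n]}},
    [/\ A QP.1, forall i, A QP.2`_i, (size QP.2 <= d)%N
      & G = F * QP.1 + mps_of_poly QP.2].
Proof.
move=> AF eF u0 G AG.
have FE l : F (mnm_last n l) = if (d <= l)%N then u (U_(ord0) *+ (l - d))%MM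
  else 0.
  rewrite -mps_subst_last_coef eF -mpsXmMn mps_coefXmM.
  have -> : (U_(ord0) *+ d <= U_(@ord0 0) *+ l)%MM = (d <= l)%N.
    apply/mnm_lepP/idP => [/(_ ord0)|le_dl i];
      rewrite !mulmnE ?ord1 mnm1E eqxx !mul1n //.
  case: leqP => // le_dl; congr (_ _ _); apply/mnmP => i.
  by rewrite mnmBE !mulmnE -mulnBr.
have F_lt l : (l < d)%N -> F (mnm_last n l) = 0 by rewrite FE ltnNge =>
  /negPf ->.
(* The constant term of U = [mps_high d F] is u(0), so U is invertible over some ring of the
   family. *)
have AU : A (mps_high d F) by have [B DB BF] := AF; exists B => // m; apply: BF.
have [|V AV UV] := directed_series_unit AU.
  rewrite /= add0m FE leqnn subnn (_ : _ *+ 0 = 0)%MM //.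
have [B1 [DB1 B1F B1G]] := directed_series2 AF AG.
have [B2 DB2 B2V] := AV.
have [B [DB le1 le2]] := directed_join dirD DB1 DB2.
have sB := directed_subring dirD DB.
have BF : mps_over B F by move=> m; apply/le1/B1F.
have BG : mps_over B G by move=> m; apply/le1/B1G.
have BV : mps_over B V by move=> m; apply/le2/B2V.
have [Q [P [BQ BP sP eG]]] := wdiv_exists F_lt UV sB BF BV BG.
exists (Q, P); split=> [|[Q' P'] /= [_ _ sP' eG']].
  by split=> //=; [exists B|move=> i; exists B].
by have [-> ->] := wdiv_unique F_lt UV sP sP' eG eG'.
Qed.

Lemma directed_series_weierstrass :
  [pchar K] =i pred0 -> weierstrass_family (directed_series D).
Proof.
split=> //.
- exact: directed_series_subalg.
- exact: directed_series_poly.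
- move=> n m f; apply: directed_series_substU; exact: lshift_inj.
- by move=> n s f Af; apply/directed_series_substU => //; apply: perm_inj.
- exact: directed_series_unit.
exact: directed_series_division.
Qed.

Lemma directed_series_blowup n (f : {mps K[n.+2]}) :
  A (mps_subst (tuple_last (@mpsX' K n.+1) (mpsX K ord0 * mpsX K ord_max)) f) ->
  A f.
Proof.
move=> [B DB Bf]; exists B => // k.
(* On exponents, x_n -> x_1 x_n adds k_n to k_1 and fixes the rest. This is injective, so each
   coefficient of f is a coefficient of the substituted series. *)
pose u (i : 'I_n.+2) : 'X_{1..n.+2} :=
  if i == ord_max then (U_(ord0) + U_(ord_max))%MM else U_(i)%MM.
have imE k' j :
    mnm_image u k' j = (k' j + if j == ord0 then k' ord_max else 0)%N.
  rewrite mnm_imageE (bigD1 ord_max) //= /u eqxx mnmDE !mnm1E.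
  have -> : (\sum_(i < n.+2 | i != ord_max) u i j * k' i =
             if j == ord_max then 0 else k' j)%N.
    case: ifPn => nj.
      rewrite big1 // => i ni; rewrite /u (negPf ni) mnm1E (eqP nj) (negPf ni).
      by rewrite mul0n.
    rewrite (bigD1 j) //= /u (negPf nj) mnm1E eqxx mul1n big1 ?addn0 //.
    by move=> i /andP[/negPf-> nij]; rewrite mnm1E (negPf nij).
  have [->|nj] := eqVneq j ord_max; first by rewrite addn0 mul1n addn0.
  rewrite [_ == j]eq_sym addn0 addnC.
  by case: eqP => _; rewrite ?mul1n ?mul0n.
have im_inj : injective (mnm_image u).
  move=> k1 k2 ek; have e j := congr1 (fun m : 'X_{1.._} => m j) ek.
  have emax : k1 ord_max = k2 ord_max by have := e ord_max;
    rewrite !imE /= !addn0.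
  by apply/mnmP => j; have := e j; rewrite !imE emax => /addIn.
have := Bf (mnm_image u k); rewrite (@mps_subst_unique _ _ _ _ (fun=> 1)).
- by rewrite big1 ?mulr1 // => i _; rewrite expr1n.
- move=> i; rewrite scale1r /tuple_last /u; case: unliftP => [j ->|->].
    by rewrite eq_sym (negPf (neq_lift _ _)).
  by rewrite eqxx mpsXmD.
- by apply: leq_mdeg_image => i; rewrite /u; case: eqP; rewrite ?mdegD !mdeg1.
by move=> k' /im_inj.
Qed.

End DirectedSeries.

(** * Residue fields and linear algebra *)

(** A free family of vectors of X has at most n members, and one of maximal length spans X. The rows
    are taken in X itself, so that later arguments can name them by indices. *)
Lemma finite_span (F : fieldType) n (X : set 'rV[F]_n) :
  exists r (A : 'M[F]_(r, n)),
    (forall i, X (row i A)) /\ forall v, X v -> (v <= A)%MS.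
Proof.
pose P r := `[< exists A : 'M[F]_(r, n), row_free A /\ forall i, X (row i A) >].
have P0 : exists r, P r.
  exists 0%N; apply/asboolP; exists 0; split=> [|[]//].
  by rewrite /row_free mxrank0.
have Ple r : P r -> (r <= n)%N.
  by case/asboolP => A [/eqP rA _]; rewrite -[leqLHS]rA rank_leq_col.
case: (ex_maxnP P0 Ple) => r /asboolP[A [freeA XA]] maxr.
exists r, A; split=> // v Xv; apply: contraT => nvA.
suff /maxr : P (1 + r)%N by rewrite ltnn.
apply/asboolP; exists (col_mx v A); split.
  have rA : \rank A = r by apply/eqP.
  rewrite /row_free eqn_leq rank_leq_row /= -addsmxE.
  have : (A < v + A)%MS by rewrite ltmxE addsmxSr addsmx_sub submx_refl andbT.
  by move/rank_ltmx; rewrite rA.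
move=> i; case: (split_ordP i) => j ->; first by rewrite rowKu row_id.
by rewrite rowKd.
Qed.

(** Independence of finitely many sequences is witnessed by finitely many of their terms: the
    columns (v_i(s))_i span the whole space as s varies, finitely many of them already do, and the
    matrix they form has a one-sided inverse C. *)
Lemma free_left_inverse (F : fieldType) (T : finType) (v : T -> nat -> F) :
    (forall a : T -> F, (forall s, \sum_i a i * v i s = 0) -> forall i,
      a i = 0) ->
  exists r (s : 'I_r -> nat) (C : 'I_r -> T -> F),
    forall i j, \sum_k v i (s k) * C k j = (i == j)%:R.
Proof.
move=> v_free.
pose c s : 'rV[F]_#|T| := \row_i v (enum_val i) s.
have [r [A [Ac cA]]] := finite_span [set c s | s in [set: nat]].
have {}Ac i : exists s, row i A = c s by have [s _ <-] := Ac i; exists s.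
have /row_fullP[C CA] : row_full A.
  rewrite -cokermx_eq0; apply/eqP/matrixP => i j; rewrite [RHS]mxE.
  rewrite -[i]enum_valK; move: (enum_val i) => {}i.
  apply: (v_free (fun t => cokermx A (enum_rank t) j)) => s.
  have /submxP[D cD] : (c s <= A)%MS by apply: cA; exists s.
  have /matrixP/(_ 0 j) : c s *m cokermx A = 0.
    by rewrite cD -mulmxA mulmx_coker mulmx0.
  rewrite !mxE => e0; rewrite -[RHS]e0 [RHS](reindex (@enum_rank T)) /=;
    last first.
    exact: onW_bij (enum_rank_bij T).
  by apply: eq_bigr => t _; rewrite [c s _ _]mxE enum_rankK mulrC.
have [s sE] := choice Ac.
exists r, s, (fun k t => C (enum_rank t) k) => i j.
transitivity ((C *m A) (enum_rank j) (enum_rank i)).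
  rewrite mxE; apply: eq_bigr => k _; rewrite mulrC; congr (_ * _).
  by have /matrixP/(_ 0 (enum_rank i)) := sE k; rewrite !mxE enum_rankK.
by rewrite CA mxE (inj_eq enum_rank_inj) eq_sym.
Qed.

Section ResidueField.
Variable S : comNzRingType.

Definition ideal_set (I : set S) : Prop :=
  [/\ I 0, forall x y, I x -> I y -> I (x + y) & forall a x, I x -> I (a * x)].

Lemma maximal_ideal (I : set S) : ideal_set I -> ~ I 1 ->
  exists M, [/\ ideal_set M, ~ M 1, I `<=` M
    & forall x, ~ M x -> exists y, M (1 - y * x)].
Proof.
move=> idI I1.
(* set0 is allowed because Zorn_bigcup includes the union of the empty chain *)
pose P (X : set S) := X = set0 \/ [/\ ideal_set X, ~ X 1 & I `<=` X].
have [|M [PM maxM]] := @Zorn_bigcup S P.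
  move=> G GP Gtot; have [[X [GX [x0 Xx0]]]|] :=
      pselect (exists X, G X /\ X !=set0); last first.
    move=> nG; left; apply/seteqP; split=> // x [X GX Xx].
    by case: nG; exists X; split=> //; exists x.
  have GI Y y : G Y -> Y y -> [/\ ideal_set Y, ~ Y 1 & I `<=` Y].
    by move=> /GP[->|//].
  have [idX X1 IX] := GI _ _ GX Xx0.
  right; split=> [|[Y GY Y1]|x /IX Xx]; last by exists X.
    split=> [|x y [Y GY Yx] [Z GZ Zy]|a x [Y GY Yx]].
    - by exists X => //; case: idX.
    - have [[_ YD _] _ _] := GI _ _ GY Yx; have [[_ ZD _] _ _] := GI _ _ GZ Zy.
      have [YZ|ZY] := Gtot _ _ GY GZ.
        by exists Z => //; apply: ZD => //; apply: YZ.
      by exists Y => //; apply: YD => //; apply: ZY.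
    by exists Y => //; have [[_ _ YM] _ _] := GI _ _ GY Yx; apply: YM.
  by have [_ nY1 _] := GI _ _ GY Y1; apply: nY1.
have [idM M1 IM] : [/\ ideal_set M, ~ M 1 & I `<=` M].
  case: PM => // M0; case: (maxM I); last by right; split.
  rewrite M0; split=> // /(_ 0); case: idI => I0 _ _ /(_ I0).
  exact.
exists M; split=> // x Mx; apply: contrapT => nx.
have [M0 MD MM] := idM.
(* The candidate larger ideal is M + (x); it does not contain 1, as x would then be invertible
   modulo M. *)
apply: (maxM [set z | exists y, M (z - y * x)]).
  split=> [z Mz|H]; first by exists 0; rewrite mul0r subr0.
  by apply: Mx; apply: H; exists 1; rewrite mul1r subrr.
right; split=> [||z Iz]; last by exists 0; rewrite mul0r subr0; apply: IM.
  split=> [|z1 z2 [y1 M1'] [y2 M2']|a z [y My]].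
  - by exists 0; rewrite mul0r subr0.
  - by exists (y1 + y2); rewrite mulrDl opprD addrACA; apply: MD.
  by exists (a * y); rewrite -mulrA -mulrBr; apply: MM.
by move=> [y My]; apply: nx; exists y.
Qed.

Lemma residue_field (I : set S) : ideal_set I -> ~ I 1 ->
  exists (F : fieldType) (phi : {rmorphism S -> F}),
    (forall y, exists x, phi x = y) /\ forall x, I x -> phi x = 0.
Proof.
move=> idI I1; have [M [idM M1 IM maxM]] := maximal_ideal idI I1.
pose Mp : pred S := fun x => `[< M x >].
have Mid : idealr_closed Mp.
  have [M0 MD MM] := idM.
  have MpE x : (x \in Mp) = `[< M x >] by [].
  split=> [||a x y]; rewrite !MpE.
  - exact/asboolP.
  - by apply/negP => /asboolP.
  by move=> /asboolP Mx /asboolP My; apply/asboolP/MD => //; apply: MM.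
pose MZ := GRing.isZmodClosed.Build _ Mp (idealr_closedB Mid).
pose MP := isProperIdeal.Build _ Mp (idealr_closed_nontrivial Mid).
pose Mi : idealr _ := HB.pack Mp MZ MP.
pose E : comNzRingType := {ideal_quot Mi}.
pose phi : {rmorphism S -> E} := \pi_E%qT.
have phi0 x : M x -> phi x = 0.
  by move=> Mx; apply/eqP; rewrite piE Quotient.equivE subr0; apply/asboolP.
have phi_surj (y : E) : exists x, phi x = y by exists (repr y);
  rewrite /phi /= reprK.
have inv_ex (z : E) : exists y : E, if z == 0 then y == 0 else y * z == 1.
  case: eqP => [_|/eqP z0]; first by exists 0.
  have [x xE] := phi_surj z.
  have [|y My] := maxM x; first by move=> /phi0; rewrite xE => /eqP;
    rewrite (negPf z0).
  exists (phi y); rewrite -xE -rmorphM -subr_eq0 -opprB oppr_eq0.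
  by rewrite -(rmorph1 phi) -rmorphB phi0.
have [Einv EinvE] := choice inv_ex.
have Einv0 : Einv 0 = 0 by have := EinvE 0; rewrite eqxx => /eqP.
have EmulV z : z != 0 -> Einv z * z = 1.
  by move=> z0; have := EinvE z; rewrite (negPf z0) => /eqP.
pose EF := GRing.ComNzRing_isField.Build _ EmulV Einv0.
pose F : fieldType := HB.pack E EF.
by exists F, phi; split=> // x /IM /phi0.
Qed.

End ResidueField.

(** * Algebraic relations of a power series in one variable *)

Section MpsMap.
Variables (n : nat) (R R' : comNzRingType) (phi : {rmorphism R -> R'}).

Definition mps_map (f : {mps R[n]}) : {mps R'[n]} := MPS (fun m => phi (f m)).

Fact mps_map_is_additive : zmod_morphism mps_map.
Proof. by move=> f g; apply: mpsP => m; rewrite /= rmorphB. Qed.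

Fact mps_map_is_multiplicative : monoid_morphism mps_map.
Proof.
split=> [|f g]; apply: mpsP => m.
  by rewrite mps_coef1 [LHS]/= mcoeff1 rmorph_nat.
by rewrite [LHS]/= rmorph_sum; apply: eq_bigr => k _; rewrite rmorphM.
Qed.

HB.instance Definition _ :=
  GRing.isZmodMorphism.Build {mps R[n]} {mps R'[n]} mps_map mps_map_is_additive.
HB.instance Definition _ :=
  GRing.isMonoidMorphism.Build {mps R[n]} {mps R'[n]} mps_map
    mps_map_is_multiplicative.

End MpsMap.

Section OneVariable.
Variable R : comNzRingType.
Local Notation X := (mpsX R (@ord0 0)).
Implicit Types (f g : {mps R[1]}) (p : {poly R}) (q : {poly {poly R}}).

Definition mnm_one l : 'X_{1..1} := (U_(ord0) *+ l)%MM.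

Lemma mnm_oneE l : mnm_one l ord0 = l.
Proof. by rewrite mulmnE mnm1E eqxx mul1n. Qed.

Lemma mnm_oneK (m : 'X_{1..1}) : mnm_one (m ord0) = m.
Proof. by apply/mnmP => i; rewrite fintype.ord1 mnm_oneE. Qed.

Lemma mnm_oneD a b : mnm_one (a + b) = (mnm_one a + mnm_one b)%MM.
Proof. by apply/mnmP => i; rewrite mnmDE fintype.ord1 !mnm_oneE. Qed.

Lemma mps_oneP f g : (forall l, f (mnm_one l) = g (mnm_one l)) -> f = g.
Proof. by move=> efg; apply: mpsP => m; rewrite -[m]mnm_oneK. Qed.

Lemma mps_coefXM_one f l :
  (X * f) (mnm_one l) = if l is l'.+1 then f (mnm_one l') else 0.
Proof.
rewrite -[X]/(mpsXm R U_(ord0)%MM) mps_coefXmM.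
have -> : (U_(@ord0 0) <= mnm_one l)%MM = (0 < l)%N.
  apply/mnm_lepP/idP => [/(_ ord0)|l_gt0 i];
    rewrite ?fintype.ord1 mnm_oneE mnm1E eqxx //.
case: l => //= l; congr (f _); apply/mnmP => i.
by rewrite mnmBE fintype.ord1 !mnm_oneE mnm1E eqxx subn1.
Qed.

(** The inclusion of R[t] in R[[t]], written with [horner_alg] because condition (c) embeds the
    coefficients of Gamma in this way. *)
Definition mps_of_poly1 : {rmorphism {poly R} -> {mps R[1]}} := horner_alg X.

Lemma mps_of_poly1_coef p l : mps_of_poly1 p (mnm_one l) = p`_l.
Proof.
elim/poly_ind: p l => [|p c IHp] l; first by rewrite rmorph0 mps_coef0 coef0.
have -> : mps_of_poly1 (p * 'X + c%:P) = X * mps_of_poly1 p + c%:A.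
  by rewrite rmorphD rmorphM /= horner_algX horner_algC mulrC.
rewrite mps_coefD mps_coefXM_one mps_coefZ mps_coef1 coefD coefMX coefC.
have -> : (mnm_one l == 0%MM) = (l == 0%N).
  by apply/eqP/eqP => [/(congr1 (fun m : 'X_{1..1} => m ord0))|->];
    rewrite ?mnm_oneE ?mnm0E //; apply/mnmP => i; rewrite mulmn0.
by case: l => [|l] /=; rewrite ?mulr1 ?mulr0 // IHp.
Qed.

Lemma mps_of_poly1_inj : injective mps_of_poly1.
Proof.
by move=> p p' e; apply/polyP => l; rewrite -!mps_of_poly1_coef e.
Qed.

Lemma mps_of_poly1_sum h p : (size p <= h)%N ->
  mps_of_poly1 p = \sum_(l < h) p`_l *: X ^+ l.
Proof.
move=> sp; have {1}-> : p = \poly_(l < h) p`_l.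
  apply/polyP => l; rewrite coef_poly; case: leqP => // le_hl.
  by rewrite nth_default // (leq_trans sp).
rewrite poly_def rmorph_sum; apply: eq_bigr => l _ /=.
by rewrite -mul_polyC rmorphM rmorphXn /= horner_algC horner_algX mps_scalerE.
Qed.

(* q(t, g(t)), for q in R[t][z] *)
Definition mps_eval g q : {mps R[1]} := (map_poly mps_of_poly1 q).[g].

Lemma mps_eval1 g : mps_eval g 1 = 1.
Proof. by rewrite /mps_eval rmorph1 hornerC. Qed.

Lemma mps_evalD g : {morph mps_eval g : q q' / q + q'}.
Proof. by move=> q q'; rewrite /mps_eval rmorphD hornerD. Qed.

Lemma mps_evalM g : {morph mps_eval g : q q' / q * q'}.
Proof. by move=> q q'; rewrite /mps_eval rmorphM hornerM. Qed.

Lemma mps_evalC g p : mps_eval g p%:P = mps_of_poly1 p.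
Proof. by rewrite /mps_eval map_polyC hornerC. Qed.

Lemma mps_evalZ g p q : mps_eval g (p *: q) = mps_of_poly1 p * mps_eval g q.
Proof. by rewrite -mul_polyC mps_evalM mps_evalC. Qed.

(** The box consists of the polynomials of degree < d in z and < h in t. For i < d and l < h these
    series are the values of its monomials at z = g(t), and a linear relation between them is a
    polynomial of the box that vanishes at g. *)
Definition box_monomial g i l : {mps R[1]} := X ^+ l * g ^+ i.

Lemma mps_eval_coef g q d h s : (size q <= d)%N ->
    (forall i, (size q`_i)%R <= h)%N ->
  mps_eval g q s =
    \sum_(a : 'I_d * 'I_h) q`_a.1`_a.2 * box_monomial g a.1 a.2 s.
Proof.
move=> sq sqi; rewrite /mps_eval (@horner_coef_wide _ d); last first.
  exact: leq_trans (size_poly _ _) sq.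
rewrite mps_coef_sum -(pair_bigA _ (fun (i : 'I_d) (l : 'I_h) =>
  q`_i`_l * box_monomial g i l s)).
apply: eq_bigr => i _.
have -> : (map_poly mps_of_poly1 q)`_i = \sum_(l < h) q`_i`_l *: X ^+ l.
  by rewrite coef_map; apply: mps_of_poly1_sum.
rewrite mulr_suml mps_coef_sum; apply: eq_bigr => l _.
by rewrite -scalerAl.
Qed.

End OneVariable.

Arguments box_monomial {R} g i l : simpl never.

Lemma mps_map_eval (R R' : comNzRingType) (phi : {rmorphism R -> R'}) g q :
  mps_map phi (mps_eval g q) =
    mps_eval (mps_map phi g) (map_poly (map_poly phi) q).
Proof.
rewrite /mps_eval -horner_map /= -!map_poly_comp; congr (_.[_]).
apply: eq_map_poly => p /=; apply: mps_oneP => l.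
by rewrite -[RHS]/(mps_of_poly1 R' _ _) !mps_of_poly1_coef coef_map /=
  -mps_of_poly1_coef.
Qed.

Lemma mps_one_integral (R : idomainType) (f g : {mps R[1]}) :
  f * g = 0 -> f != 0 -> g = 0.
Proof.
move=> fg0 f0; apply: contrapT => /eqP g0.
have nz (h : {mps R[1]}) : h != 0 -> exists l, h (mnm_one l) != 0.
  move=> h0; apply: contrapT => nh; case/eqP: h0; apply: mps_oneP => l.
  by rewrite mps_coef0; apply/eqP; apply: contrapT => /negP nhl; apply: nh;
    exists l.
(* With a and b the orders of f and g, the coefficient of the product at a + b is the product of the
   two lowest coefficients. *)
case: (ex_minnP (nz f f0)) => a fa mina;
  case: (ex_minnP (nz g g0)) => b gb minb.
have f_lt (m : 'X_{1..1}) : (m ord0 < a)%N -> f m = 0.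
  rewrite ltnNge -{2}[m]mnm_oneK => ma; apply/eqP; apply: contraNT ma;
    exact: mina.
have g_lt (m : 'X_{1..1}) : (m ord0 < b)%N -> g m = 0.
  rewrite ltnNge -{2}[m]mnm_oneK => mb; apply/eqP; apply: contraNT mb;
    exact: minb.
have := congr1 (fun h : {mps R[1]} => h (mnm_one (a + b))) fg0.
have lta : (mdeg (mnm_one a) < (mdeg (mnm_one (a + b))).+1)%N.
  by rewrite !mdegMn mdeg1 !mul1n ltnS leq_addr.
have ltb : (mdeg (mnm_one b) < (mdeg (mnm_one (a + b))).+1)%N.
  by rewrite !mdegMn mdeg1 !mul1n ltnS leq_addl.
rewrite mps_coefM mps_coef0 (bigD1 (BMultinom lta, BMultinom ltb)) /=;
  last first.
  by rewrite mnm_oneD.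
rewrite [X in _ + X]big1 => [|[k1 k2] /= /andP[/eqP ek nk]].
  by apply/eqP; rewrite addr0 mulf_neq0.
have {}ek : (k1 ord0 + k2 ord0 = a + b)%N.
  by rewrite -mnmDE -ek mnm_oneE.
have [lt1|lt1|eq1] := ltngtP (k1 ord0) a.
- by rewrite f_lt ?mul0r.
- rewrite [g _]g_lt ?mulr0 //.
  by rewrite -(ltn_add2l (k1 ord0)) ek ltn_add2r.
case/eqP: nk; congr (_, _); apply: val_inj => /=;
  rewrite -[LHS]mnm_oneK ?eq1 //.
by congr mnm_one; apply/eqP; rewrite -(eqn_add2l (k1 ord0)) ek eq1.
Qed.

(** * Gauss' lemma and polynomial relations of a power series *)

Section PolynomialContent.
Variable F : fieldType.
Implicit Types (c a b : {poly F}) (A B : {poly {poly F}}).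

(** Take a nonconstant divisor p of c of least size: gcd(p, a) is either constant or, by minimality,
    p itself up to a unit. *)
Lemma prime_factor c : (1 < size c)%N ->
  exists p : {poly F}, [/\ (1 < size p)%N, p %| c
    & forall a b, p %| a * b -> p %| a \/ p %| b].
Proof.
move=> c_gt1.
pose P s := `[< exists p : {poly F}, [/\ (1 < size p)%N,
  p %| c & size p = s] >].
have P0 : exists s, P s by exists (size c); apply/asboolP; exists c;
  rewrite dvdpp.
case: (ex_minnP P0) => s /asboolP[p [p_gt1 pc ps]] mins.
exists p; split=> // a b pab; have [co|nco] := boolP (coprimep p a).
  by right; rewrite -(Gauss_dvdpr _ co).
left; have c0 : c != 0 by rewrite -size_poly_gt0 (leq_ltn_trans _ c_gt1).
have p0 : p != 0 by rewrite -size_poly_gt0 (leq_ltn_trans _ p_gt1).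
have g_gt1 : (1 < size (gcdp p a))%N.
  rewrite ltn_neqAle eq_sym -/(coprimep p a) nco lt0n size_poly_eq0.
  by rewrite gcdp_eq0 negb_and p0.
have : (s <= size (gcdp p a))%N.
  by apply/mins/asboolP; exists (gcdp p a);
    rewrite (dvdp_trans (dvdp_gcdl _ _) pc).
rewrite -ps => sg; have : gcdp p a %= p.
  by rewrite -dvdp_size_eqp ?dvdp_gcdl // eqn_leq sg dvdp_leq ?dvdp_gcdl.
by move=> /eqp_dvdl <-; apply: dvdp_gcdr.
Qed.

(** If i and k are the first indices where p fails to divide A_i and B_k, the coefficient of A B at
    i + k is A_i B_k modulo p. *)
Lemma content_prime p A B :
    (forall a b, p %| a * b -> p %| a \/ p %| b) ->
    (forall i, p %| (A * B)`_i) ->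
  (forall i, p %| A`_i) \/ (forall i, p %| B`_i).
Proof.
move=> p_prime pAB; have [|nA] := pselect (forall i, p %| A`_i); first by left.
have [|nB] := pselect (forall i, p %| B`_i); first by right.
have ex (D : {poly {poly F}}) : ~ (forall i, p %| D`_i) -> exists i,
  ~~ (p %| D`_i).
  move=> nD; apply: contrapT => H; apply: nD => i; apply: contraT => nd.
  by case: H; exists i.
case: (ex_minnP (ex A nA)) => i pAi mini;
  case: (ex_minnP (ex B nB)) => k pBk mink.
have := pAB (i + k)%N; rewrite coefM.
have lt_i : (i < (i + k).+1)%N by rewrite ltnS leq_addr.
rewrite (bigD1 (Ordinal lt_i)) //= addKn dvdp_addl; last first.
  apply: (big_ind (fun x => p %| x)) => [|x y|l nl];
    [exact: dvdp0|exact: dvdp_add|].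
  have [lt_li|lt_il|eq_li] := ltngtP l i.
  - apply: dvdp_mulr; apply: contraT => /mini; by rewrite leqNgt lt_li.
  - apply: dvdp_mull; apply: contraT => /mink.
    rewrite leqNgt ltn_subLR ?ltn_add2r ?lt_il //.
    by rewrite -ltnS.
  by case/eqP: nl; apply: val_inj.
by move=> /p_prime[]; [rewrite (negPf pAi)|rewrite (negPf pBk)].
Qed.

Lemma content_div p A : (forall i, p %| A`_i) -> exists A1, A = p *: A1.
Proof.
move=> pA; exists (map_poly (fun a => a %/ p) A); apply/polyP => i.
by rewrite coefZ coef_map_id0 ?div0p // mulrC divpK.
Qed.

End PolynomialContent.

Section AnnihilatorFactor.
Variables (F : fieldType) (g : {mps F[1]}).
Implicit Types (G q : {poly {poly F}}).

(* Gauss: clear the common prime factors in an identity c G = A q. *)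
Lemma annihilator_clear (c : {poly F}) G A q : c != 0 -> c *: G = A * q ->
    q != 0 -> mps_eval g q = 0 ->
  exists A' q', [/\ G = A' * q', mps_eval g q' = 0 & (size q' <= size q)%N].
Proof.
have [s] := ubnP (size c); elim: s c A q => // s IHs c A q.
rewrite ltnS => sc c0 eG q0 gq.
have [c_gt1|c_le1] := ltnP 1 (size c); last first.
  have /size_poly1P[a a0 ca] : size c == 1%N.
    by rewrite eqn_leq c_le1 size_poly_gt0.
  exists ((a^-1)%:P *: A), q; split=> //; rewrite -scalerAl -eG scalerA ca.
  by rewrite -polyCM mulVf // scale1r.
have [p [p_gt1 /dvdpP[c1 ec] p_prime]] := prime_factor c_gt1.
have p0 : p != 0 by rewrite -size_poly_gt0 (leq_ltn_trans _ p_gt1).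
have c10 : c1 != 0 by apply: contraNneq c0; rewrite ec => ->; rewrite mul0r.
have sc1 : (size c1 < s)%N.
  apply: leq_trans sc; rewrite ec size_mul //.
  by rewrite -subn1 -addnBA ?(ltnW p_gt1) // -[ltnLHS]addn0 ltn_add2l subn_gt0.
have pAq i : p %| (A * q)`_i by rewrite -eG coefZ ec dvdp_mulr // dvdp_mull.
have pI : injective (fun B : {poly {poly F}} => p *: B).
  by move=> B B'; rewrite -!mul_polyC; apply: mulfI; rewrite polyC_eq0.
(* By Gauss' lemma p divides A or q. In the second case q / p still vanishes at g, F[[t]] being a
   domain. *)
have [/content_div[A1 eA]|/content_div[q1 eq]] := content_prime p_prime pAq.
  apply: (IHs c1 A1 q) => //; apply: pI.
  by rewrite scalerA mulrC -ec eG eA scalerAl.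
have eG1 : c1 *: G = A * q1.
  by apply: pI; rewrite scalerA mulrC -ec eG eq scalerAr.
have q10 : q1 != 0 by apply: contraNneq q0; rewrite eq => ->; rewrite scaler0.
have gq1 : mps_eval g q1 = 0.
  apply: (@mps_one_integral _ (mps_of_poly1 _ p));
    first by rewrite -mps_evalZ -eq.
  by rewrite -(rmorph0 (mps_of_poly1 F)) (inj_eq (@mps_of_poly1_inj _)).
have [A' [q' [eG' gq' sq']]] := IHs c1 A q1 sc1 c10 eG1 q10 gq1.
exists A', q'; split=> //; apply: leq_trans sq' _.
by rewrite eq -mul_polyC size_Cmul.
Qed.

(** Let q1 be a nonzero relation of least degree in z. Pseudo-division of G by q1 leaves no
    remainder, and Gauss' lemma turns c G = A q1 into a factorization of G over F[t]. *)
Lemma annihilator_factor G q : q != 0 -> mps_eval g q = 0 -> mps_eval g G = 0 ->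
  exists A q', [/\ G = A * q', mps_eval g q' = 0 & (size q' <= size q)%N].
Proof.
move=> q0 gq gG.
pose P s := `[< exists q : {poly {poly F}}, [/\ q != 0,
  mps_eval g q = 0 & size q = s] >].
have P0 : exists s, P s by exists (size q); apply/asboolP; exists q.
case: (ex_minnP P0) => s /asboolP[q1 [q10 gq1 sq1]] mins.
have sq : (size q1 <= size q)%N by rewrite sq1; apply/mins/asboolP; exists q.
have eG := Pdiv.Idomain.divp_eq G q1.
have r0 : G %% q1 = 0.
  apply: contrapT => /eqP r0; have := ltn_modpN0 G q10.
  rewrite ltnNge sq1 => /negP[]; apply/mins/asboolP; exists (G %% q1);
    split=> //.
  have := congr1 (mps_eval g) eG.
  by rewrite mps_evalD mps_evalZ mps_evalM gG gq1 !mulr0 add0r.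
rewrite r0 addr0 in eG.
have c0 : lead_coef q1 ^+ scalp G q1 != 0 by rewrite expf_neq0 // lead_coef_eq0.
have [A [q' [eG' gq' sq']]] := annihilator_clear c0 eG q10 gq1.
by exists A, q'; split=> //; apply: leq_trans sq' sq.
Qed.

(** A relation of degree below that of G would yield a factor q' of G that is one too. Degrees in t
    add up in G = A q', so q' respects the bound h of G: excluding relations in the box excludes
    them for every degree in t. *)
Lemma annihilator_box G h : G \is monic -> mps_eval g G = 0 ->
    (forall i, (size (G`_i)%R <= h)%N) ->
    (forall q, (size q < size G)%N -> (forall i, (size (q`_i)%R <= h)%N) ->
       mps_eval g q = 0 -> q = 0) ->
  forall q, (size q < size G)%N -> mps_eval g q = 0 -> q = 0.
Proof.
move=> G_monic gG Gh box q sq gq; apply: contrapT => /eqP q0.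
have [A [q' [eG gq' sq']]] := annihilator_factor q0 gq gG.
have G0 := monic_neq0 G_monic.
case/eqP: (G0); rewrite eG (box q') ?mulr0 //;
  first exact: leq_ltn_trans sq' sq.
move=> i; apply: leq_trans (max_size_coefXY _ _) _.
have A0 : A != 0 by apply: contraNneq G0 => A0; rewrite eG A0 mul0r.
have q'0 : q' != 0 by apply: contraNneq G0 => q'0; rewrite eG q'0 mulr0.
have : (sizeY G <= h)%N by apply/bigmax_leqP => l _; apply: Gh.
apply: leq_trans; rewrite eG !sizeYE rmorphM size_mul ?swapXY_eq0 //.
rewrite -subn1 addnC -addnBA ?leq_addr // size_poly_gt0 swapXY_eq0 //.
Qed.

(** In G = A q' either A is a unit, and then q' has the full degree of G, or q' is a unit, and then
    it cannot vanish at g. *)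
Lemma annihilator_irreducible G : irreducible_elt G -> G \is monic ->
    mps_eval g G = 0 ->
  forall q, (size q < size G)%N -> mps_eval g q = 0 -> q = 0.
Proof.
move=> [_ _ G_irr] G_monic gG q sq gq; apply: contrapT => /eqP q0.
have [A [q' [eG gq' sq']]] := annihilator_factor q0 gq gG.
have G0 := monic_neq0 G_monic.
have q'0 : q' != 0 by apply: contraNneq G0 => q'0; rewrite eG q'0 mulr0.
have [uA|uq'] := G_irr _ _ eG.
  have A0 : A != 0 by apply: contraTneq uA => ->; rewrite unitr0.
  move: uA; rewrite poly_unitE => /andP[/eqP sA _].
  by move: sq; rewrite eG size_mul // sA add1n /= ltnNge sq'.
have /eqP := mps_evalM g q' q'^-1; rewrite divrr // mps_eval1 gq' mul0r.
by rewrite oner_eq0.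
Qed.

End AnnihilatorFactor.

Lemma box_monomial_free (R : comNzRingType) (g : {mps R[1]}) d m :
    (forall q : {poly {poly R}}, (size q <= d)%N -> mps_eval g q = 0 ->
      q = 0) ->
  forall a : 'I_d * 'I_m -> R,
    (forall s, \sum_b a b * box_monomial g b.1 b.2 (mnm_one s) = 0) ->
  forall b, a b = 0.
Proof.
move=> indep a a0.
pose q : {poly {poly R}} := \poly_(i < d) \poly_(l < m)
  (if (insub i, insub l) is (Some i', Some l') then a (i', l') else 0).
have qE (b : 'I_d * 'I_m) : q`_b.1`_b.2 = a b.
  by case: b => i l; rewrite /q /= coef_poly ltn_ord coef_poly ltn_ord !valK.
suff q0 : q = 0 by move=> b; rewrite -qE q0 !coef0.
apply: indep; first exact: size_poly.
apply: mps_oneP => l; rewrite (@mps_eval_coef _ _ _ d m) ?size_poly //.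
  by rewrite mps_coef0 -[RHS](a0 l); apply: eq_bigr => b _; rewrite qE.
by move=> i; rewrite coef_poly; case: ifP => _; rewrite ?size_poly ?size_poly0.
Qed.

(** * Polynomials in z whose value at g has its coefficients in a subring *)

Section IntegralCoefficients.
Variables (S : comNzRingType) (K : fieldType) (sigma : {rmorphism S -> K}).
Variables (d h : nat) (G : {poly {poly S}}) (g : {mps S[1]}).
Hypothesis G_monic : G \is monic.
Hypothesis sG : size G = d.+1.
Hypothesis Gh : forall i, (size (G`_i)%R <= h)%N.
Hypothesis gG : mps_eval g G = 0.

Lemma mps_map_box (R : comNzRingType) (phi : {rmorphism S -> R}) i l :
  mps_map phi (box_monomial g i l) = box_monomial (mps_map phi g) i l.
Proof.
rewrite rmorphM !rmorphXn; congr (_ ^+ _ * _).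
by apply: mpsP => m /=; rewrite !mcoeffX rmorph_nat.
Qed.

Variables (r : nat) (s : 'I_r -> nat) (C : 'I_r -> 'I_d * 'I_h -> S).
(* A left inverse for the coefficients of the t^l g^i: it shows that these
   series remain independent over every residue field of S. *)
Hypothesis C_inv : forall a b : 'I_d * 'I_h,
  \sum_k box_monomial g a.1 a.2 (mnm_one (s k)) * C k b = (a == b)%:R.

(** The image of C over F is still a left inverse, which excludes relations in the box;
    [annihilator_box] extends this to all degrees in t. *)
Lemma residue_independent (F : fieldType) (phi : {rmorphism S -> F}) (q :
  {poly {poly F}}) :
  (size q <= d)%N -> mps_eval (mps_map phi g) q = 0 -> q = 0.
Proof.
pose GF := map_poly (map_poly phi) G.
have sGF : size GF = d.+1.
  by rewrite size_map_poly_id0 // (monicP G_monic) rmorph1 oner_neq0.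
rewrite -ltnS -sGF; apply: annihilator_box (h) _ _ _ _ _.
- exact: monic_map.
- by rewrite -mps_map_eval gG rmorph0.
- by move=> i; rewrite coef_map /=; apply: leq_trans (size_poly _ _) (Gh i).
move=> {}q; rewrite sGF ltnS => sq sqh gq.
apply/polyP => i; apply/polyP => l; rewrite coef0 coef0.
have [lt_id|le_di] := ltnP i d; last first.
  by rewrite (nth_default _ (leq_trans sq le_di)) coef0.
have [lt_lh|le_hl] := ltnP l h; last first.
  exact: nth_default _ (leq_trans (sqh i) le_hl).
pose b := (Ordinal lt_id, Ordinal lt_lh).
transitivity (\sum_k mps_eval (mps_map phi g) q (mnm_one (s k)) * phi (C k b)).
  under eq_bigr do rewrite (mps_eval_coef _ _ sq sqh) mulr_suml.
  rewrite exchange_big.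
  transitivity (\sum_(a : 'I_d * 'I_h) q`_a.1`_a.2 * (a == b)%:R).
    rewrite (bigD1 b) //= eqxx mulr1 big1 ?addr0 // => a /negPf->.
    by rewrite mulr0.
  apply: eq_bigr => a _; rewrite -(rmorph_nat phi) -C_inv rmorph_sum mulr_sumr.
  by apply: eq_bigr => k _; rewrite rmorphM -mulrA -mps_map_box.
by apply: big1 => k _; rewrite gq mps_coef0 mul0r.
Qed.

(** The c in S such that c q has its coefficients in S form an ideal I. If I were proper, it would
    vanish in a residue field F, where the t^l g^i stay independent for any range of l. A left
    inverse over F, lifted to S, gives a linear system for the coefficients of q with matrix Y and
    right-hand side in S. Cramer's rule puts det Y in I, although det Y is 1 in F. *)
Lemma integral_coefficients (q : {poly {poly K}}) : (size q <= d)%N ->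
    (forall l, exists x, sigma x = mps_eval (mps_map sigma g) q (mnm_one l)) ->
  forall i l, exists x, sigma x = q`_i`_l.
Proof.
move=> sq qS.
pose I : set S := [set c | forall i l, exists x, sigma x = sigma c * q`_i`_l].
have idI : ideal_set I.
  split=> [i l|x y Ix Iy i l|a x Ix i l].
  - by exists 0; rewrite rmorph0 mul0r.
  - have [x' ex] := Ix i l; have [y' ey] := Iy i l.
    by exists (x' + y'); rewrite !rmorphD ex ey mulrDl.
  by have [x' ex] := Ix i l; exists (a * x'); rewrite !rmorphM ex mulrA.
have [I1|I1] := pselect (I 1).
  by move=> i l; have [x ex] := I1 i l; exists x; rewrite ex rmorph1 mul1r.
exfalso; have [F [phi [phi_surj phiI]]] := residue_field idI I1.
(* This bounds the degree in t of the given q and may exceed h: here independence beyond the box is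
   used. *)
pose m := (\max_(i < size q) size (q`_i)%R)%N.
have sqm i : (size (q`_i)%R <= m)%N.
  have [lt_i|le_i] := ltnP i (size q); last by rewrite nth_default //
    size_poly0.
  exact: (leq_bigmax (Ordinal lt_i)).
have [] := @free_left_inverse F ('I_d * 'I_m)%type
    (fun a l => box_monomial (mps_map phi g) a.1 a.2 (mnm_one l)).
  by apply: box_monomial_free => q'; apply: residue_independent.
move=> r' [s' [C' C'E]].
have [D DE] := choice
  (fun kb : 'I_r' * ('I_d * 'I_m) => phi_surj (C' kb.1 kb.2)).
pose T : finType := ('I_d * 'I_m)%type.
pose v (a : T) l := box_monomial g a.1 a.2 (mnm_one l).
pose Y := \matrix_(i < #|T|, j < #|T|)
  \sum_k v (enum_val i) (s' k) * D (k, enum_val j).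
have phiY : map_mx phi Y = 1%:M.
  apply/matrixP => i j; rewrite !mxE rmorph_sum -(inj_eq enum_val_inj) -C'E.
  by apply: eq_bigr => k _; rewrite rmorphM DE -mps_map_box.
have detY : phi (\det Y) = 1 by rewrite -det_map_mx phiY det1.
suff /phiI : I (\det Y) by rewrite detY => /eqP; rewrite oner_eq0.
pose w := \row_(i < #|T|) q`_(enum_val i).1`_(enum_val i).2.
have wY j : exists x, sigma x = (w *m map_mx sigma Y) 0 j.
  have [x xE] := choice qS.
  exists (\sum_k x (s' k) * D (k, enum_val j)); rewrite rmorph_sum mxE.
  under eq_bigr do rewrite rmorphM xE (mps_eval_coef _ _ sq sqm) mulr_suml.
  rewrite exchange_big (reindex (@enum_val T predT)); last first.
    exact: onW_bij (enum_val_bij T).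
  apply: eq_bigr => i _; rewrite !mxE rmorph_sum mulr_sumr;
    apply: eq_bigr => k _.
  by rewrite rmorphM mulrA -mps_map_box.
have wdet j : exists x, sigma x = sigma (\det Y) * w 0 j.
  have [x xE] := choice wY.
  exists (\sum_i x i * (\adj Y) i j); rewrite rmorph_sum.
  transitivity ((w *m (map_mx sigma Y *m \adj (map_mx sigma Y))) 0 j).
    rewrite mulmxA [RHS]mxE; apply: eq_bigr => i _.
    rewrite rmorphM xE; congr (_ * _); by rewrite -map_mx_adj [RHS]mxE.
  by rewrite mul_mx_adj det_map_mx mul_mx_scalar mxE.
move=> i l; have [lt_id|le_di] := ltnP i d; last first.
  by exists 0; rewrite rmorph0 (nth_default _ (leq_trans sq le_di)) coef0 mulr0.
have [lt_lm|le_ml] := ltnP l m; last first.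
  by exists 0; rewrite rmorph0 (nth_default _ (leq_trans (sqm i) le_ml)) mulr0.
have := wdet (enum_rank (Ordinal lt_id, Ordinal lt_lm)).
by rewrite mxE enum_rankK.
Qed.

End IntegralCoefficients.

(** * Conjugate roots *)

Section SubringType.
Variables (K : comNzRingType) (B : set K) (subB : subring_set B).

Definition subring_pred : {pred K} := fun x => `[< B x >].

Fact subring_pred_closed : subring_closed subring_pred.
Proof.
split=> [|x y /asboolP Bx /asboolP By|x y /asboolP Bx /asboolP By];
  apply/asboolP.
- exact: subring_set1.
- exact: subring_setB.
exact: subring_setM.
Qed.

HB.instance Definition _ :=
  GRing.isSubringClosed.Build K subring_pred subring_pred_closed.

Record subring_type := SubringElt {
  subring_val : K;
  _ : subring_val \in subring_pred
}.

HB.instance Definition _ := [isSub for subring_val].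
HB.instance Definition _ := [Choice of subring_type by <:].
HB.instance Definition _ := [SubChoice_isSubComNzRing of subring_type by <:].

(** Residue fields and monic division need a ring type, whereas the rings B are sets in K; this
    passes from one to the other. *)
Lemma subring_set_image : exists (S : comNzRingType) (sigma : {rmorphism S ->
  K}),
  injective sigma /\ forall x, B x <-> exists y, sigma y = x.
Proof.
exists subring_type, (\val : {rmorphism subring_type -> K}).
split=> [|x]; first exact: val_inj.
split=> [Bx|[[y /asboolP By] <-] //].
by exists (SubringElt (introT (asboolP _) Bx : x \in subring_pred)).
Qed.

End SubringType.

Lemma map_poly_surj (S K : nzRingType) (sigma : {rmorphism S -> K}) (p :
  {poly K}) :
  (forall i, exists x, sigma x = p`_i) -> exists p', map_poly sigma p' = p.
Proof.
move=> /choice[x xE]; exists (\poly_(i < size p) x i); apply/polyP => i.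
rewrite coef_map coef_poly /=; case: leqP => // le_pi.
by rewrite rmorph0 nth_default.
Qed.

Section TwoVariables.
Variable R : comNzRingType.
Implicit Types (f : {mps R[2]}) (g : {mps R[1]}).

Definition mnm_two k l : 'X_{1..2} := (U_(ord0) *+ k + U_(ord_max) *+ l)%MM.

Lemma mnm_two0 k l : mnm_two k l ord0 = k.
Proof. by rewrite mnmDE !mulmnE !mnm1E /= mul1n mul0n addn0. Qed.

Lemma mnm_two1 k l : mnm_two k l ord_max = l.
Proof. by rewrite mnmDE !mulmnE !mnm1E /= mul1n mul0n. Qed.

Lemma mnm_two_eq (m m' : 'X_{1..2}) :
  m ord0 = m' ord0 -> m ord_max = m' ord_max -> m = m'.
Proof.
move=> e0 e1; apply/mnmP => i; case: (unliftP ord_max i) => [j|] -> //.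
by have -> : lift ord_max j = ord0 by apply: val_inj; rewrite /= fintype.ord1.
Qed.

Lemma mnm_twoK (m : 'X_{1..2}) : mnm_two (m ord0) (m ord_max) = m.
Proof. by apply: mnm_two_eq; rewrite ?mnm_two0 ?mnm_two1. Qed.

Definition mps_at_x2 g : {mps R[2]} :=
  mps_subst (fun _ : 'I_1 => mpsX R (@ord_max 1)) g.

Lemma mps_at_x2_coef g m :
  mps_at_x2 g m = if m ord0 == 0%N then g (mnm_one (m ord_max)) else 0.
Proof.
have h_inj : injective (fun _ : 'I_1 => @ord_max 1).
  by move=> i j _; rewrite !fintype.ord1.
have imE (k : 'X_{1..1}) :
    mnm_image (fun _ : 'I_1 => U_(@ord_max 1))%MM k = mnm_two 0 (k ord0).
  apply: mnm_two_eq; rewrite ?mnm_two0 ?mnm_two1;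
    last exact: (mnm_imageU h_inj k ord0).
  exact: mnm_imageU_out.
case: eqP => [m0|m0].
  rewrite -[in LHS](mnm_twoK m) m0 -[in LHS](mnm_oneE (m ord_max)) -imE.
  exact: (mps_substU_coef h_inj).
apply: (mps_substU_notin (h := fun=> ord_max)) => k; rewrite imE => em.
by apply: m0; rewrite -em mnm_two0.
Qed.

Definition mps_slice1 k f : {mps R[1]} := MPS (fun m => f (mnm_two k (m ord0))).

Lemma mps_slice1_sum I (r : seq I) (P : pred I) (F : I -> {mps R[2]}) k :
  mps_slice1 k (\sum_(i <- r | P i) F i) = \sum_(i <- r | P i) mps_slice1 k (F
    i).
Proof.
apply: (big_morph (mps_slice1 k)) => [f f'|]; first exact: mpsP.
by apply: mpsP => m; rewrite mps_coef0 /= mcoeff0.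
Qed.

Lemma mps_slice1M k f g : mps_slice1 k (f * mps_at_x2 g) = mps_slice1 k f * g.
Proof.
apply: mps_oneP => l.
(* The coefficient of x_1^k x_2^l involves g only up to degree l, so g may be replaced by its
   truncation, and then by a monomial. *)
pose g1 : {mps R[1]} := \sum_(i < l.+1) g (mnm_one i) *: mpsXm R (mnm_one i).
pose g2 : {mps R[2]} := \sum_(i < l.+1) g (mnm_one i) *: mpsXm R (mnm_two 0 i).
have g1E (v : 'X_{1..1}) : (v ord0 <= l)%N -> g v = g1 v.
  rewrite -ltnS => lt_v; rewrite mps_coef_sum (bigD1 (Ordinal lt_v)) //=.
  rewrite mcoeffX mnm_oneK eqxx mulr1 big1 ?addr0 // => i ni.
  rewrite mcoeffX; case: eqP => [ev|_]; last by rewrite mulr0.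
  by case/eqP: ni; apply: val_inj; rewrite /= -ev mnm_oneE.
have g2E (v : 'X_{1..2}) : (v ord_max <= l)%N -> mps_at_x2 g v = g2 v.
  rewrite mps_at_x2_coef -ltnS => lt_v; rewrite mps_coef_sum.
  case: eqP => [v0|v0].
    rewrite (bigD1 (Ordinal lt_v)) //=.
    have ev : mnm_two 0 (v ord_max) = v by rewrite -[RHS]mnm_twoK v0.
    rewrite mcoeffX ev eqxx mulr1 big1 ?addr0 // => i ni.
    rewrite mcoeffX; case: eqP => [ei|_]; last by rewrite mulr0.
    by case/eqP: ni; apply: val_inj; rewrite /= -ei mnm_two1.
  rewrite big1 // => i _; rewrite mps_coefZ mps_coefXm.
  by case: eqP => [ev|_]; rewrite ?mulr0 //; case: v0; rewrite -ev mnm_two0.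
transitivity ((f * g2) (mnm_two k l)).
  rewrite -[in RHS](mnm_oneE l) [LHS]/((f * mps_at_x2 g) (mnm_two k (mnm_one l
    ord0))).
  apply: mps_mull_ext => u v em; rewrite g2E //.
  by rewrite -[leqRHS](mnm_oneE l) -(mnm_two1 k (mnm_one l ord0)) -em mnmDE
    leq_addl.
transitivity ((mps_slice1 k f * g1) (mnm_one l)); last first.
  apply: mps_mull_ext => u v em; rewrite g1E //.
  by rewrite -[leqRHS](mnm_oneE l) -em mnmDE leq_addl.
rewrite !mulr_sumr !mps_coef_sum; apply: eq_bigr => i _.
rewrite -!scalerAr !mps_coefZ; congr (_ * _);
  rewrite ![_ * mpsXm _ _]mulrC !mps_coefXmM.
have le_i : (i <= l)%N by rewrite -ltnS.
have -> : (mnm_two 0 i <= mnm_two k l)%MM.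
  apply/mnm_lepP => a; case: (unliftP ord_max a) => [a'|] ->;
    rewrite ?mnm_two1 //.
  have -> : lift ord_max a' = ord0 :> 'I_2.
    by apply: val_inj; rewrite /= fintype.ord1.
  by rewrite !mnm_two0.
have -> : (mnm_one i <= mnm_one l)%MM.
  by apply/mnm_lepP => a; rewrite fintype.ord1 !mnm_oneE.
rewrite [RHS]/(f _); congr (f _); apply: mnm_two_eq.
  by rewrite mnmBE !mnm_two0 subn0.
by rewrite mnmBE !mnm_two1 mnmBE !mnm_oneE.
Qed.

Lemma mps_slice1_horner k (P : {poly {mps R[2]}}) g (q : {poly {poly R}}) :
    (forall j l, (P`_j) (mnm_two k l) = q`_j`_l) ->
  mps_slice1 k P.[mps_at_x2 g] = mps_eval g q.
Proof.
move=> Pq; rewrite (@horner_coef_wide _ (maxn (size P) (size q))) ?leq_maxl //.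
rewrite mps_slice1_sum /mps_eval.
rewrite (@horner_coef_wide _ (maxn (size P) (size q))); last first.
  by rewrite (leq_trans (size_poly _ _)) ?leq_maxr.
apply: eq_bigr => j _.
have -> : (map_poly (mps_of_poly1 R) q)`_j = mps_slice1 k P`_j.
  by rewrite coef_map; apply: mps_oneP => l;
    rewrite [LHS]mps_of_poly1_coef /= mnm_oneE Pq.
move: (nat_of_ord j) (P`_j) => i f; elim: i => [|i IHi];
  first by rewrite !expr0 !mulr1.
by rewrite !exprSr !mulrA mps_slice1M IHi.
Qed.

End TwoVariables.

Section Conjugate.
Variables (K : fieldType) (D : set (set K)).
Hypothesis dirD : directed_subrings D.
Local Notation A := (directed_series D).

Lemma directed_series_conj (Gamma : {poly {poly K}}) (g g' : {mps K[1]})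
    (P : {poly {mps K[2]}}) (p : nat -> {poly {poly K}}) :
    irreducible_elt Gamma -> Gamma \is monic -> A g -> A g' ->
    mps_eval g Gamma = 0 -> mps_eval g' Gamma = 0 ->
    (forall j k l, (P`_j) (mnm_two k l) = (p k)`_j`_l) ->
  A P.[mps_at_x2 g] -> A P.[mps_at_x2 g'].
Proof.
move=> G_irr G_monic Ag Ag' gG g'G Pp APg.
pose d := (size Gamma).-1.
have sG : size Gamma = d.+1 by rewrite prednK // size_poly_gt0 monic_neq0.
pose h := (\max_(i < size Gamma) size (Gamma`_i)%R)%N.
have Gh i : (size (Gamma`_i)%R <= h)%N.
  have [lt_i|le_i] := ltnP i (size Gamma);
    last by rewrite nth_default // size_poly0.
  exact: (leq_bigmax (Ordinal lt_i)).
(* Over K the t^l g^i are independent because Gamma is irreducible. The left inverse C that results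
   is put in B together with the coefficients of Gamma, g, g' and P(x, g(x_2)). *)
have indep (q : {poly {poly K}}) : (size q <= d)%N -> mps_eval g q = 0 -> q = 0.
  by rewrite -ltnS -sG; apply: annihilator_irreducible.
have [r [s [C CE]]] := free_left_inverse (box_monomial_free (m := h) indep).
have [B1 [DB1 B1g B1g']] := directed_series2 dirD Ag Ag'.
have [B2 DB2 B2P] := APg.
have [B3 [DB3 le13 le23]] := directed_join dirD DB1 DB2.
have [B [DB le3 BC]] := directed_seq dirD
  ([seq C a.1 a.2 | a : 'I_r * ('I_d * 'I_h)]
     ++ flatten [seq (c : seq K) | c : {poly K} <- Gamma]) DB3.
have sB := directed_subring dirD DB.
have Bg m : B (g m) by apply/le3/le13/B1g.
have Bg' m : B (g' m) by apply/le3/le13/B1g'.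
have BPg m : B (P.[mps_at_x2 g] m) by apply/le3/le23/B2P.
have BG i l : B Gamma`_i`_l.
  have [lt_i|le_i] := ltnP i (size Gamma); last first.
    by rewrite (nth_default _ le_i) coef0; apply: subring_set0.
  have [lt_l|le_l] := ltnP l (size Gamma`_i); last first.
    by rewrite (nth_default _ le_l); apply: subring_set0.
  apply: BC; rewrite mem_cat; apply/orP; right; apply/flattenP.
  exists (Gamma`_i : seq K); last exact: mem_nth.
  by apply: (map_f (fun c : {poly K} => (c : seq K))); apply: mem_nth.
have [S [sigma [sigma_inj BE]]] := subring_set_image sB.
have [GS GSE] : exists GS, map_poly (map_poly sigma) GS = Gamma.
  by apply: map_poly_surj => i; apply: map_poly_surj => l; apply/BE.
have [gS gSE] := choice (fun m => iffLR (BE _) (Bg m)).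
have gE : mps_map sigma (MPS gS) = g by apply: mpsP => m /=.
have BCab k b : exists x, sigma x = C k b.
  apply/BE/BC; rewrite mem_cat; apply/orP; left.
  by apply/mapP; exists (k, b); rewrite ?mem_enum.
have [CS CSE] := choice (fun kb : 'I_r * ('I_d * 'I_h) => BCab kb.1 kb.2).
have mapS_inj : injective (map_poly sigma) :=
  map_inj_poly sigma_inj (rmorph0 _).
have GS_monic : GS \is monic.
  apply/eqP/mapS_inj; rewrite rmorph1 -(monicP G_monic) -GSE.
  by rewrite lead_coef_map_inj // rmorph0.
have sGS : size GS = d.+1 by rewrite -sG -GSE (size_map_inj_poly mapS_inj
  (rmorph0 _)).
have GSh i : (size (GS`_i)%R <= h)%N.
  by have := Gh i; rewrite -GSE coef_map (size_map_inj_poly sigma_inj (rmorph0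
    _)).
have gGS : mps_eval (MPS gS) GS = 0.
  apply: mpsP => m; apply: sigma_inj; rewrite mps_coef0 rmorph0.
  have := congr1 (fun f : {mps K[1]} => f m) (mps_map_eval sigma (MPS gS) GS).
  by rewrite gE GSE gG mps_coef0.
have CS_inv (a b : 'I_d * 'I_h) :
    \sum_k box_monomial (MPS gS) a.1 a.2 (mnm_one (s k)) * CS (k,
      b) = (a == b)%:R.
  apply: sigma_inj; rewrite rmorph_sum rmorph_nat -CE; apply: eq_bigr => k _.
  by rewrite rmorphM CSE -gE -mps_map_box.
exists B => // m; rewrite -[m]mnm_twoK; set k := m ord0; set l := m ord_max.
have slE (f : {mps K[1]}) l' :
    P.[mps_at_x2 f] (mnm_two k l') = mps_eval f (p k) (mnm_one l').
  by rewrite -(mps_slice1_horner _ (fun j => Pp j k)) /= mnm_oneE.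
(* The remainder takes the same values as p_k at both roots. Its value at g shows that its
   coefficients lie in B, and then so do those of its value at g'. *)
pose q := Pdiv.Ring.rmodp (p k) Gamma.
have pE := Pdiv.RingMonic.rdivp_eq G_monic (p k).
have qE (f : {mps K[1]}) : mps_eval f Gamma = 0 ->
  mps_eval f (p k) = mps_eval f q.
  by move=> fG; rewrite {1}pE mps_evalD mps_evalM fG mulr0 add0r.
have sq : (size q <= d)%N.
  by rewrite -ltnS -sG; apply: Pdiv.Ring.ltn_rmodpN0; apply: monic_neq0.
have Bq i j : B q`_i`_j.
  apply/BE; apply: (integral_coefficients GS_monic sGS GSh gGS CS_inv sq) =>
    {}j.
  by apply/BE; rewrite gE -qE // -slE.
rewrite slE qE //.
have sB1 := mps_over_subring 1 sB.
apply: (subring_set_horner sB1) => // i a.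
by rewrite coef_map -[a]mnm_oneK [mpscoef _ _]mps_of_poly1_coef.
Qed.

End Conjugate.

(** * The rings of Eisenstein series *)

Section Localization.
Variable O : idomainType.
Local Notation E := {fraction O}.
Implicit Types (f g : O) (x : E).

Lemma fraction_ratio x : exists a b : O, b != 0 /\ x = tofrac a / tofrac b.
Proof.
exists (frac (repr x)).1, (frac (repr x)).2.
have d0 := denom_ratioP (repr x); split=> //.
have dF : tofrac (frac (repr x)).2 != 0 by rewrite tofrac_eq0.
apply: (mulIf dF); rewrite divfK // -{1}[x]reprK; set r := repr x.
rewrite -[LHS]/(FracField.mul _ _) !piE; apply/eqmodP => /=.
rewrite FracField.equivfE /FracField.mulf !numden_Ratio ?mulf_neq0 ?oner_neq0
  ?d0 //.
by rewrite !mulr1 mulrC.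
Qed.

Lemma localization_subring f : f != 0 -> subring_set (localization f).
Proof.
move=> f0; have fk0 k : tofrac f ^+ k != 0 by rewrite expf_neq0 ?tofrac_eq0.
split=> [|_ _ [a [k ->]] [b [l ->]]|_ _ [a [k ->]] [b [l ->]]].
- by exists 1, 0%N; rewrite expr0 divr1 tofrac1.
- exists (a * f ^+ l - b * f ^+ k), (k + l)%N.
  rewrite tofracB !tofracM !tofracXn exprD -mulNr addf_div //.
  by rewrite mulNr [_ ^+ k * _ ^+ l]mulrC [_ ^+ l * _ ^+ k]mulrC.
by exists (a * b), (k + l)%N; rewrite tofracM exprD mulf_div.
Qed.

Lemma localization_tofrac f a : localization f (tofrac a).
Proof. by exists a, 0%N; rewrite expr0 divr1. Qed.

Lemma localization_mull f g : f != 0 -> g != 0 ->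
  localization g `<=` localization (f * g).
Proof.
move=> f0 g0 _ [a [k ->]]; exists (a * f ^+ k), k.
rewrite !tofracM tofracXn exprMn [in RHS](mulrC (tofrac f ^+ k)) -mulf_div.
by rewrite divff ?mulr1 // expf_neq0 ?tofrac_eq0.
Qed.

Lemma localization_mulr f g : f != 0 -> g != 0 ->
  localization f `<=` localization (f * g).
Proof. by rewrite mulrC => f0 g0; apply: localization_mull. Qed.

Lemma localization_frac x : exists2 f, f != 0 & localization f x.
Proof.
have [a [b [b0 ->]]] := fraction_ratio x; exists b => //.
by exists a, 1%N; rewrite expr1.
Qed.

Lemma localization_seq f (s : seq E) : f != 0 ->
  exists g, [/\ g != 0, localization f `<=` localization g
              & {in s, forall x, localization g x}].
Proof.
move=> f0; elim: s => [|x s [g [g0 fg gs]]]; first by exists f; split=> // x.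
have [h h0 hx] := localization_frac x; exists (h * g).
split=> [|y /fg|y]; first by rewrite mulf_neq0.
  exact: localization_mull.
rewrite inE => /predU1P[->|/gs]; first exact: localization_mulr.
exact: localization_mull.
Qed.

End Localization.

Lemma adjoin_subring (R : comNzRingType) (B : set R) c :
  subring_set B -> subring_set (adjoin B c).
Proof.
move=> sB; split=> [|_ _ [P BP ->] [Q BQ ->]|_ _ [P BP ->] [Q BQ ->]].
- exists 1; last by rewrite hornerC.
  move=> i; rewrite coef1; case: eqP => _; last exact: subring_set0.
  exact: subring_set1.
- exists (P - Q); last by rewrite hornerD hornerN.
  by move=> i; rewrite coefB; apply: subring_setB.
exists (P * Q); last by rewrite hornerM.
by move=> i; rewrite coefM; apply: subring_set_sum => // k _;
  apply: subring_setM.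
Qed.

Lemma adjoin_base (R : comNzRingType) (B : set R) c : B 0 -> B `<=` adjoin B c.
Proof.
move=> B0 x Bx; exists x%:P; last by rewrite hornerC.
by move=> i; rewrite coefC; case: ifP.
Qed.

Lemma adjoin_gen (R : comNzRingType) (B : set R) c :
  subring_set B -> adjoin B c c.
Proof.
move=> sB; exists 'X; last by rewrite hornerX.
move=> i; rewrite coefX; case: eqP => _; last exact: subring_set0.
exact: subring_set1.
Qed.

Section EisensteinRings.
Variables (O : idomainType) (K : fieldType) (iota :
  {rmorphism {fraction O} -> K}).
Local Notation E := {fraction O}.
Implicit Types (f g : O) (c : K).

Definition frac_ring f : set K := iota @` localization f.

Definition adjoin_bounded f c N : Prop := forall x, adjoin (frac_ring f) c x ->
  exists P : {poly E}, [/\ forall i, localization f P`_i, (size P <= N)%N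
                         & x = (map_poly iota P).[c]].

(* O_f[c] for c integral over O_f, in the form of the finiteness of O_f[c] *)
Definition eisenstein_rings : set (set K) :=
  [set B | exists f c, [/\ f != 0, B = adjoin (frac_ring f) c
                         & exists N, adjoin_bounded f c N]].

Lemma frac_ring_subring f : f != 0 -> subring_set (frac_ring f).
Proof.
move=> /localization_subring sf.
split=> [|_ _ [x fx <-] [y fy <-]|_ _ [x fx <-] [y fy <-]].
- by exists 1; [apply: subring_set1|rewrite rmorph1].
- by exists (x - y); [apply: subring_setB|rewrite rmorphB].
by exists (x * y); [apply: subring_setM|rewrite rmorphM].
Qed.

Lemma frac_ring_poly f (P : {poly K}) : (forall i, frac_ring f P`_i) ->
  exists2 Q : {poly E}, forall i, localization f Q`_i & P = map_poly iota Q.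
Proof.
move=> fP; have fP' i : exists x, localization f x /\ iota x = P`_i.
  by have [x fx xP] := fP i; exists x.
have [x xE] := choice fP'; exists (\poly_(i < size P) x i).
  move=> i; rewrite coef_poly; case: ifP => _; first by have [] := xE i.
  by exists 0, 0%N; rewrite tofrac0 mul0r.
apply/polyP => i; rewrite coef_map coef_poly /=; have [_ ei] := xE i.
by case: leqP => // le_Pi; rewrite rmorph0 nth_default.
Qed.

Hypothesis K_alg : forall z : K, algebraicOver iota z.

(** c is a root of a monic polynomial p over Frac(O). Once the coefficients of p are in O_g,
    polynomials in c can be reduced modulo p over O_g. *)
Lemma adjoin_finite f c : f != 0 ->
  exists g N, [/\ g != 0, localization f `<=` localization g & adjoin_bounded g
    c N].
Proof.
move=> f0; have [p p_monic pc] := iffLR (integral_algebraic _ _) (K_alg c).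
have [g [g0 fg gp]] := localization_seq p f0.
have sg := localization_subring g0.
exists g, (size p); split=> // _ [P /frac_ring_poly[Q gQ ->] ->].
have [S [sigma [sigma_inj gE]]] := subring_set_image sg.
have lift (q : {poly E}) : (forall i, localization g q`_i) ->
    exists q', map_poly sigma q' = q.
  by move=> gq; apply: map_poly_surj => i; apply/gE.
have [|p' p'E] := lift p.
  move=> i; have [lt_i|le_i] := ltnP i (size p); last first.
    by rewrite nth_default //; apply: subring_set0.
  by apply: gp; apply: mem_nth.
have [Q' Q'E] := lift Q gQ.
have p'_monic : p' \is monic.
  apply/eqP/sigma_inj; rewrite rmorph1 -(monicP p_monic) -p'E.
  by rewrite lead_coef_map_inj // rmorph0.
exists (map_poly sigma (Pdiv.Ring.rmodp Q' p')); split.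
- by move=> i; apply/gE; rewrite coef_map; eexists.
- rewrite -p'E !(size_map_inj_poly sigma_inj (rmorph0 _)) ltnW //.
  by apply: Pdiv.Ring.ltn_rmodpN0; apply: monic_neq0.
rewrite -{1}Q'E {1}(Pdiv.RingMonic.rdivp_eq p'_monic Q') !rmorphD !rmorphM /=.
by rewrite p'E hornerD hornerM (rootP pc) mulr0 add0r.
Qed.

Lemma frac_ring_sub f g : localization f `<=` localization g ->
  frac_ring f `<=` frac_ring g.
Proof. by move=> fg _ [x fx <-]; exists x => //; apply: fg. Qed.

Lemma adjoin_sub f g c d : g != 0 -> localization f `<=` localization g ->
    adjoin (frac_ring g) d c ->
  adjoin (frac_ring f) c `<=` adjoin (frac_ring g) d.
Proof.
move=> g0 fg gc _ [P fP ->]; have sg := frac_ring_subring g0.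
apply: (subring_set_horner (adjoin_subring d sg)) => // i.
apply: adjoin_base; first exact: subring_set0.
exact: (frac_ring_sub fg).
Qed.

Lemma eisenstein_ring_exists f c : f != 0 -> exists B, [/\ eisenstein_rings B,
  adjoin (frac_ring f) c `<=` B & B c].
Proof.
move=> f0; have [g [N [g0 fg gN]]] := adjoin_finite c f0.
have Bc := adjoin_gen c (frac_ring_subring g0).
exists (adjoin (frac_ring g) c); split=> //; last exact: adjoin_sub.
by exists g, c; split=> //; exists N.
Qed.

Lemma eisenstein_directed : [pchar O] =i pred0 ->
  directed_subrings eisenstein_rings.
Proof.
move=> char0; split.
- by move=> _ [f [c [f0 -> _]]]; apply/adjoin_subring/frac_ring_subring.
- move=> _ _ [f1 [c1 [f10 -> _]]] [f2 [c2 [f20 -> _]]].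
  have [p1 p10 p1c] := K_alg c1; have [p2 p20 p2c] := K_alg c2.
  have charE : [pchar E] =i pred0.
    move=> n; rewrite !inE -(rmorph_nat (@tofrac O)) tofrac_eq0.
    by have := char0 n; rewrite !inE.
  (* Primitive element: c1 = q1(c) and c2 = q2(c). Both belong to O_f[c] once f clears the
     denominators of q1 and q2. *)
  have [n [[q1 q1E] [q2 q2E]]] := pchar0_PET p10 p1c p20 p2c charE.
  set c := _ - c1 in q1E q2E.
  have [f [f0 f12 fq]] := localization_seq (q1 ++ q2) (mulf_neq0 f10 f20).
  have sf := frac_ring_subring f0.
  have fc (q : {poly E}) : {subset (q : seq E) <= (q1 ++ q2 : seq E)} ->
      adjoin (frac_ring f) c (map_poly iota q).[c].
    move=> sub_q; exists (map_poly iota q) => // i; rewrite coef_map.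
    have [lt_i|le_i] := ltnP i (size q); last first.
      rewrite (nth_default _ le_i) raddf0; exact: subring_set0.
    by exists q`_i => //; apply/fq/sub_q/mem_nth.
  have [B [DB fB _]] := eisenstein_ring_exists c f0.
  exists B; split=> // x xc; apply: fB; move: x xc; apply: adjoin_sub => //.
  + by move=> x /(localization_mulr f10 f20)/f12.
  + by rewrite -q1E; apply: fc => x; rewrite mem_cat => ->.
  + by move=> x /(localization_mull f10 f20)/f12.
  by rewrite -q2E; apply: fc => x; rewrite mem_cat orbC => ->.
move=> x; have [B [DB _ Bx]] := eisenstein_ring_exists x (oner_neq0 O).
by exists B.
Qed.

(** To regroup a series over O_f[c] by powers of c, as a polynomial in c over O_f[[x]], the degrees
    in c must be bounded independently of the exponent: this is where the finiteness of O_f[c]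
    enters. *)
Lemma eisensteinE n : eisenstein iota (n :=
  n) = directed_series eisenstein_rings (n := n).
Proof.
apply/seteqP; split=> F.
  move=> [c _ [f /= f0 [P fP ->]]].
  have [g [N [g0 fg gN]]] := adjoin_finite c f0.
  have sg := adjoin_subring c (frac_ring_subring g0).
  exists (adjoin (frac_ring g) c).
    by exists g, c; split=> //; exists N.
  apply: (subring_set_horner (mps_over_subring n sg)) => [i m|].
    apply: adjoin_base; last exact: (frac_ring_sub fg) (fP i m).
    exact: subring_set0 (frac_ring_subring g0).
  apply: mps_over_scale => //; first exact: adjoin_gen (frac_ring_subring g0).
  exact: subring_set1 (mps_over_subring n sg).
move=> [B [f [c [f0 -> [N fN]]]] BF].
have [P PE] := choice (fun m => fN _ (BF m)).
exists c => //; exists f => //; exists (\poly_(i < N) MPS (fun m =>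
  iota (P m)`_i)).
  move=> i m; rewrite coef_poly; case: ifP => _ /=.
    by exists (P m)`_i => //; have [] := PE m.
  by rewrite mcoeff0; apply: subring_set0 (frac_ring_subring f0).
apply: mpsP => m; have [fP sP ->] := PE m.
rewrite [in RHS]horner_poly mps_coef_sum (@horner_coef_wide _ N); last first.
  exact: leq_trans (size_poly _ _) sP.
by apply: eq_bigr => i _; rewrite mps_algX coef_map [X in mpscoef X]mulrC
  mps_scalerE mps_coefZ mulrC.
Qed.

End EisensteinRings.

(** * Sections of a power series *)

Lemma uncountable_pigeonhole T (L : set T) (S : nat -> set T) :
    ~ countable L -> (forall x, L x -> exists N, S N x) ->
  exists N, ~ finite_set (L `&` S N).
Proof.
move=> L_unc LS; apply: contrapT => fin; apply: L_unc.
have -> : L = \bigcup_(N in [set: nat]) (L `&` S N).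
  apply/seteqP; split=> [x Lx|x [N _ []] //].
  by have [N SNx] := LS _ Lx; exists N.
apply: bigcup_countable => // N _; apply: finite_set_countable.
by apply: contrapT => H; apply: fin; exists N.
Qed.

(** Induction on the degree: with Q - Q(l0) = Q1 (X - l0), the value Q1(l) is (Q(l) - Q(l0)) / (l -
    l0), which stays in V because V is stable under the field k. Removing l0 keeps L infinite. *)
Lemma interpolation (R : comNzRingType) (k : fieldType) (kk : {rmorphism k ->
  R})
    (V : set R) (L : set k) (Q : {poly R}) :
    V 0 -> (forall x y, V x -> V y -> V (x - y)) ->
    (forall l x, V x -> V (kk l * x)) ->
    ~ finite_set L -> (forall l, L l -> V Q.[kk l]) ->
  forall i, V Q`_i.
Proof.
move=> V0 VB VM.
have [n] := ubnP (size Q); elim: n L Q => // n IHn L Q;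
  rewrite ltnS => sQ Linf LQ.
case: n => [|n] in IHn sQ.
  by move: sQ; rewrite leqn0 size_poly_eq0 => /eqP-> i; rewrite coef0.
have [l0 Ll0] : L !=set0.
  by apply/set0P; apply: contra_notN Linf => /eqP ->.
have [Q1 Q1E] : exists Q1, Q - Q.[kk l0]%:P = Q1 * ('X - (kk l0)%:P).
  by apply/factor_theorem; rewrite rootE hornerD hornerN hornerC subrr.
have QE : Q = Q1 * ('X - (kk l0)%:P) + Q.[kk l0]%:P by rewrite -Q1E subrK.
have VQ1 i : V Q1`_i.
  apply: (IHn (L `\` [set l0])).
  - have [->|Q10] := eqVneq Q1 0; first by rewrite size_poly0.
    have : (size (Q - Q.[kk l0]%:P)%R <= n.+1)%N.
      apply: leq_trans (size_polyD _ _) _; rewrite geq_max sQ size_polyN.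
      by rewrite (leq_trans (size_polyC_leq1 _)).
    by rewrite Q1E size_Mmonic ?monicXsubC // size_XsubC addn2.
  - move=> fin; apply: Linf; apply: sub_finite_set (_ :
    _ `<=` (L `\` [set l0]) `|` [set l0]) _.
      by move=> l Ll; have [->|/eqP ll0] := eqVneq l l0; [right|left].
    by rewrite finite_setU; split.
  move=> l [Ll /eqP ll0]; have := VM (l - l0)^-1 _ (VB _ _ (LQ _ Ll) (LQ _
    Ll0)).
  have /(congr1 (fun q : {poly R} => q.[kk l])) := Q1E.
  rewrite hornerD hornerN hornerC hornerM hornerXsubC => ->.
  by rewrite mulrC -mulrA -rmorphB -rmorphM divff ?subr_eq0 // rmorph1 mulr1.
move=> i; rewrite QE coefD mulrBr coefB coefMX coefMC coefC -[X in _ + X]opprK.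
apply: (VB); last first.
  by case: eqP => _; rewrite -[X in V X]sub0r; apply: (VB) => //; apply: LQ.
apply: (VB); first by case: eqP.
by rewrite mulrC; apply: VM.
Qed.

(** * Divisibility and denominators in a unique factorization domain *)

Section Ufd.
Variable O : idomainType.
Hypothesis hO : ufd O.
Local Notation E := {fraction O}.
Implicit Types (a b c p : O) (x y : E).

Definition divides p a : Prop := exists b, a = p * b.

Lemma divides_mem_prod p (s : seq O) : p \in s -> divides p (\prod_(q <- s) q).
Proof.
move=> ps; exists (\prod_(q <- rem p s) q).
by rewrite (perm_big _ (perm_to_rem ps)) big_cons.
Qed.

Lemma divides_mulr p a b : divides p a -> divides p (a * b).
Proof. by move=> [c ->]; exists (c * b); rewrite mulrA. Qed.

Lemma divides_mull p a b : divides p b -> divides p (a * b).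
Proof. by rewrite mulrC; apply: divides_mulr. Qed.

Lemma irreducible_unitM p c : c \is a GRing.unit -> irreducible_elt p ->
  irreducible_elt (p * c).
Proof.
move=> uc [p0 np p_irr]; split.
- by rewrite mulf_neq0 //; apply: contraTneq uc => ->; rewrite unitr0.
- by rewrite unitrM uc andbT.
move=> a b e; have : p = a * (b / c) by rewrite mulrA -e mulrK.
move=> /p_irr[ua|ub]; [by left|right].
by move: ub; rewrite unitrM unitrV uc andbT.
Qed.

Lemma ufd_prime p a b : irreducible_elt p -> divides p (a * b) ->
  divides p a \/ divides p b.
Proof.
move=> p_irr [c e]; have [p0 np _] := p_irr.
have [->|a0] := eqVneq a 0; first by left; exists 0; rewrite mulr0.
have [->|b0] := eqVneq b 0; first by right; exists 0; rewrite mulr0.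
have [ua|na] := boolP (a \is a GRing.unit).
  by right; exists (c / a); rewrite mulrA -e mulrC mulKr.
have [ub|nb] := boolP (b \is a GRing.unit).
  by left; exists (c / b); rewrite mulrA -e mulrK.
have [s s_irr sE] := ufd_factor hO a0 na;
  have [t t_irr tE] := ufd_factor hO b0 nb.
(* A factorization of p c whose first member q is a multiple of p, to be compared with the factors
   of a and b. A unit c has no factorization of its own and is absorbed into p. *)
have [q [l [pq ql_irr qlE]]] : exists q l,
    [/\ divides p q, {in q :: l, forall r, irreducible_elt r}
       & \prod_(r <- q :: l) r = p * c].
  have [uc|nc] := boolP (c \is a GRing.unit).
    exists (p * c), [::]; split; [by exists c| |by rewrite big_seq1].
    by move=> x; rewrite inE => /eqP->; apply: irreducible_unitM.
  have c0 : c != 0.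
    by apply: contraTneq (mulf_neq0 a0 b0) => c0; rewrite e c0 mulr0 eqxx.
  have [l l_irr lE] := ufd_factor hO c0 nc.
  exists p, l; split; [by exists 1; rewrite mulr1| |by rewrite big_cons -lE].
  by move=> x; rewrite inE => /predU1P[->//|/l_irr].
have [||t' [st sz assoc]] := ufd_unique hO ql_irr (t := s ++ t).
- by move=> x; rewrite mem_cat => /orP[/s_irr|/t_irr].
- by rewrite big_cat /= -sE -tE qlE e.
have [u _ t'0] := assoc 0%N isT.
have : divides p t'`_0 by rewrite t'0 /=; apply: divides_mull.
have : t'`_0 \in s ++ t by rewrite (perm_mem st) mem_nth // -sz.
rewrite mem_cat => /orP[] /divides_mem_prod[d dE] [h hE].
  by left; rewrite sE dE hE; exists (h * d); rewrite mulrA.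
by right; rewrite tE dE hE; exists (h * d); rewrite mulrA.
Qed.

(** Writing y = b / g^l gives p b = a g^l. The prime p divides a, and then y is in O, or it divides
    g, and then p is invertible in O_g. *)
Lemma prime_denominator p g y a : irreducible_elt p -> g != 0 ->
    localization g y -> tofrac p * y = tofrac a ->
  (exists b, y = tofrac b) \/ localization g (tofrac p)^-1.
Proof.
move=> p_irr g0 [b [l yE]] py; have [p0 np _] := p_irr.
have gl0 : tofrac g ^+ l != 0 by rewrite expf_neq0 ?tofrac_eq0.
have : p * b = a * g ^+ l.
  apply/eqP; rewrite -tofrac_eq !tofracM -py tofracXn yE -mulrA divfK //.
move=> e; have : divides p (a * g ^+ l) by exists b.
move=> /(ufd_prime p_irr)[[d dE]|pg].
  by left; exists d; apply: (@mulfI _ (tofrac p));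
    rewrite ?tofrac_eq0 // py dE tofracM.
right; have {pg} [h hE] : divides p g.
  elim: {e gl0 yE} l pg => [[d dE]|l IHl]; last first.
    by rewrite exprS => /(ufd_prime p_irr)[|/IHl].
  by case/negP: np; apply/unitrPr; exists d; rewrite -dE.
have h0 : h != 0 by apply: contraNneq g0 => h0; rewrite hE h0 mulr0.
exists h, 1%N; rewrite expr1 hE tofracM invfM mulrCA divff ?mulr1 ?tofrac_eq0
  //.
Qed.

Lemma ufd_factor_unit f : f != 0 -> exists u s,
  [/\ u \is a GRing.unit, {in s, forall p, irreducible_elt p}
    & f = u * \prod_(p <- s) p].
Proof.
move=> f0; have [uf|nf] := boolP (f \is a GRing.unit).
  by exists f, [::]; rewrite big_nil mulr1.
have [s s_irr sE] := ufd_factor hO f0 nf.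
by exists 1, s; rewrite unitr1 mul1r.
Qed.

(* The denominators that can occur in O_f and in some O_{g_M} come from the
   finitely many prime factors of f. *)
Lemma ufd_stable_denominator f (g : nat -> O) : f != 0 -> (forall N,
  g N != 0) ->
    (forall N M, (N <= M)%N -> localization (g N) `<=` localization (g M)) ->
  exists N, forall M x, localization f x -> localization (g M) x ->
    localization (g N) x.
Proof.
move=> f0 g0 g_mono; have [u [s [uu s_irr fE]]] := ufd_factor_unit f0.
have [N NP] : exists N, forall p, p \in s -> forall M,
    localization (g M) (tofrac p)^-1 -> localization (g N) (tofrac p)^-1.
  elim: s {s_irr fE} => [|p s [N NP]]; first by exists 0%N.
  have [[M gM]|nM] := pselect (exists M, localization (g M) (tofrac p)^-1).
    exists (maxn M N) => q; rewrite inE => /predU1P[-> _ _|qs M' gM'].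
      by apply: g_mono gM; rewrite leq_maxl.
    by apply: g_mono (NP _ qs _ gM'); rewrite leq_maxr.
  exists N => q; rewrite inE => /predU1P[-> M gM|/NP //].
  by case: nM; exists M.
exists N => M; have gN := localization_subring (g0 N);
  have gM := localization_subring (g0 M).
(* The primes of the denominator are removed one at a time: one that is inverted in O_{g_N} is
   harmless, and any other divides the numerator by [prime_denominator] and the choice of N. *)
have clear (l : seq O) x a : {subset l <= s} -> localization (g M) x ->
    x * tofrac (\prod_(p <- l) p) = tofrac a -> localization (g N) x.
  elim: l x a => [|p l IHl] x a ls xM; rewrite ?big_nil ?big_cons.
    by rewrite tofrac1 mulr1 => ->; apply: localization_tofrac.
  have ps : p \in s by apply: ls; rewrite mem_head.
  have {}ls : {subset l <= s} by move=> q ql; apply: ls; rewrite inE ql orbT.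
  have pF0 : tofrac p != 0 by rewrite tofrac_eq0; have [] := s_irr _ ps.
  rewrite tofracM => xa.
  have [pN|npN] := pselect (localization (g N) (tofrac p)^-1).
    rewrite -(mulfK pF0 x); apply: (subring_setM gN) => //.
    apply: (IHl _ a ls); last by rewrite -mulrA.
    by apply: (subring_setM gM) => //; apply: localization_tofrac.
  have [||[b yb]|pM] := @prime_denominator p (g M) (x * tofrac (\prod_(p <- l)
    p)) a (s_irr _ ps) (g0 M).
  - by apply: (subring_setM gM) => //; apply: localization_tofrac.
  - by rewrite mulrCA.
  - exact: IHl ls xM yb.
  by case: npN; apply: NP pM.
move=> x [a [r xE]] xM.
have uF : tofrac u * tofrac u^-1 = 1 by rewrite -tofracM mulrV // tofrac1.
apply: (clear (flatten (nseq r s)) x (a * u^-1 ^+ r)) => //.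
  by move=> p /flattenP[l /nseqP[-> _]].
have -> : \prod_(p <- flatten (nseq r s)) p = (\prod_(p <- s) p) ^+ r.
  elim: {xE} r => [|r IHr]; first by rewrite big_nil.
  by rewrite /= big_cat IHr exprS.
have fr0 : tofrac f ^+ r != 0 by rewrite expf_neq0 ?tofrac_eq0.
rewrite tofracM !tofracXn; apply: (mulIf (_ : tofrac u ^+ r != 0)).
  by rewrite expf_neq0 // tofrac_eq0; apply: contraTneq uu => ->;
    rewrite unitr0.
rewrite -mulrA -exprMn [tofrac (\prod_(_ <- _) _) * _]mulrC -tofracM -fE xE
  divfK //.
by rewrite -mulrA -exprMn [tofrac u^-1 * _]mulrC uF expr1n mulr1.
Qed.

End Ufd.

Section SectionPoly.
Variables (n : nat) (R : comNzRingType).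
Implicit Types (F : {mps R[n.+2]}) (k : 'X_{1..n.+2}) (m : 'X_{1..n.+1}).

Definition section_mnm (i : 'I_n.+2) : 'X_{1..n.+1} :=
  if unlift ord_max i is Some j then U_(j)%MM else U_(ord0)%MM.

(* the coefficient at m of F(x', l x_1), as a polynomial in l *)
Definition section_poly F m : {poly R} :=
  \sum_(k : 'X_{1..n.+2 < (mdeg m).+1} | mnm_image section_mnm k == m)
    F k *: 'X^(k ord_max).

Lemma section_mnm_gt0 i : (0 < mdeg (section_mnm i))%N.
Proof. by rewrite /section_mnm; case: unlift => [j|]; rewrite mdeg1. Qed.

Lemma section_polyE F l m :
  mps_subst (tuple_last (@mpsX n.+1 R) (l *: mpsX R ord0)) F m
    = (section_poly F m).[l].
Proof.
rewrite (@mps_subst_monomial _ _ _ section_mnm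
           (fun i => if i == ord_max then l else 1)); last first.
  move=> i; rewrite /tuple_last /section_mnm; case: unliftP => [j ->|->].
    by rewrite eq_sym (negPf (neq_lift _ _)) scale1r.
  by rewrite eqxx.
rewrite horner_sum; apply: eq_bigr => k _; rewrite hornerZ hornerXn.
rewrite (bigD1 ord_max) //= eqxx [X in _ * (_ * X)]big1 ?mulr1 // => i /negPf->.
by rewrite expr1n.
Qed.

Lemma section_poly_horner F l m : (section_poly F m).[l] =
  \sum_(k : 'X_{1..n.+2 < (mdeg m).+1} | mnm_image section_mnm k == m)
    F k * l ^+ (k ord_max).
Proof.
by rewrite horner_sum; apply: eq_bigr => k _; rewrite hornerZ hornerXn.
Qed.

Lemma section_image k j :
  mnm_image section_mnm k j = (k (lift ord_max j) + (ord0 == j) * k ord_max)%N.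
Proof.
rewrite mnm_imageE (bigD1 ord_max) //= /section_mnm unlift_none mnm1E addnC.
congr (_ + _)%N; rewrite (bigD1 (lift ord_max j)) /=; last first.
  by rewrite eq_sym neq_lift.
rewrite liftK mnm1E eqxx mul1n big1 ?addn0 // => i /andP[].
case: (unliftP ord_max i) => [j' -> _|->]; last by rewrite eqxx.
by rewrite (inj_eq lift_inj) mnm1E => /negPf->.
Qed.

(** An exponent k is determined by its image and its last entry, so monomials of F never merge: each
    coefficient of F is a coefficient of one of these polynomials in l. *)
Lemma section_poly_coef F k :
  (section_poly F (mnm_image section_mnm k))`_(k ord_max) = F k.
Proof.
rewrite coef_sum.
have lt_k : (mdeg k < (mdeg (mnm_image section_mnm k)).+1)%N.
  by rewrite ltnS leq_mdeg_image //; apply: section_mnm_gt0.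
rewrite (bigD1 (BMultinom lt_k)) //= coefZ coefXn eqxx mulr1.
rewrite [X in _ + X]big1 ?addr0 // => k' /andP[/eqP ek nk].
rewrite coefZ coefXn; case: eqP => [emax|_]; last by rewrite mulr0.
case/eqP: nk; apply: val_inj; apply/mnmP => i /=.
case: (unliftP ord_max i) => [j|] -> //.
have := congr1 (fun m : 'X_{1..n.+1} => m j) ek.
by rewrite !section_image emax => /addIn.
Qed.

Variables (k0 : fieldType) (kk : {rmorphism k0 -> R}) (V : set R).
Hypotheses (V0 : V 0) (VB : forall x y, V x -> V y -> V (x - y)).
Hypothesis VM : forall l x, V x -> V (kk l * x).

Lemma section_poly_in F l m :
    (forall k, (mdeg k <= mdeg m)%N -> V (F k)) ->
  V (section_poly F m).[kk l].
Proof.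
move=> VF; rewrite section_poly_horner; apply: big_ind => // [x y Vx Vy|k _].
  by rewrite -[y]opprK; apply: VB => //; rewrite -sub0r; apply: VB.
by rewrite mulrC -rmorphXn; apply/VM/VF; rewrite -ltnS bmdeg.
Qed.

Lemma section_poly_interpolation F (L : set k0) : ~ finite_set L ->
  (forall l, L l -> forall m, V (section_poly F m).[kk l]) -> forall k, V (F k).
Proof.
move=> Linf VL k; rewrite -section_poly_coef.
by apply: (interpolation V0 VB VM Linf) => l /VL.
Qed.

End SectionPoly.

(** * Sections of series over the fraction field, then over K *)

Section FractionSections.
Variables (O : idomainType) (hO : ufd O) (k : fieldType) (j : {rmorphism k ->
  O}).
Local Notation E := {fraction O}.

Definition frac_scalar : {rmorphism k -> E} := @tofrac O \o j.

Lemma localization_scalar (f : O) l x : f != 0 ->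
  localization f x -> localization f (frac_scalar l * x).
Proof.
move=> f0 fx; apply: (subring_setM (localization_subring f0)) => //.
exact: localization_tofrac.
Qed.

(** [g N] clears the denominators of the coefficients of F of degree < N. At a given l, each
    coefficient of the section lies both in O_f and in some O_{g_M}, hence in O_{g_N} for one N
    depending on l. Infinitely many l share an N, and interpolation applies over O_{g_N}. *)
Lemma frac_sections n (F : {mps E[n.+2]}) (L : set k) : ~ countable L ->
    (forall l, L l -> exists2 f, f != 0 &
       forall m, localization f (section_poly F m).[frac_scalar l]) ->
  exists2 f, f != 0 & forall m, localization f (F m).
Proof.
move=> L_unc LF; have /choice[d dP] : forall m, exists f : O,
  f != 0 /\ localization f (F m).
  by move=> m; have [f f0 fF] := localization_frac (F m); exists f.
have d0 m : d m != 0 by have [] := dP m.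
have dF m : localization (d m) (F m) by have [] := dP m.
pose G i := \prod_(m : 'X_{1..n.+2 < i.+1}) d m.
have G0 i : G i != 0 by apply/prodf_neq0 => m _; apply: d0.
pose g N := \prod_(0 <= i < N) G i.
have g0 N : g N != 0 by rewrite /g big_mkord; apply/prodf_neq0 => i _;
  apply: G0.
have g_mono N M : (N <= M)%N -> localization (g N) `<=` localization (g M).
  move=> le_NM; have gE : g M = g N * \prod_(N <= i < M) G i by rewrite
    -big_cat_nat.
  have := g0 M; rewrite gE mulf_eq0 negb_or => /andP[_ ?].
  exact: localization_mulr.
have gF N m : (mdeg m < N)%N -> localization (g N) (F m).
  move=> lt_mN; apply: (g_mono _ _ lt_mN); rewrite /g big_nat_recr //=.
  apply: localization_mull => //; first exact: (g0 (mdeg m)).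
  rewrite /G (bigD1 (BMultinom (ltnSn (mdeg m)))) //=.
  by apply: (localization_mulr (d0 m)) => //; apply/prodf_neq0 => m' _;
    apply: d0.
have [|N Ninf] := @uncountable_pigeonhole _ L
    (fun N => [set l | forall m, localization (g N) (section_poly F
      m).[frac_scalar l]]) L_unc.
  move=> l Ll; have [f f0 fF] := LF l Ll.
  have [N NP] := ufd_stable_denominator hO f0 g0 g_mono.
  exists N => m; apply: (NP (mdeg m).+1) => //.
  have gm := localization_subring (g0 (mdeg m).+1).
  apply: section_poly_in.
  - exact: subring_set0.
  - exact: subring_setB.
  - by move=> l' x; apply: localization_scalar.
  by move=> k' le_k'; apply: gF.
exists (g N) => //; have gN := localization_subring (g0 N).
apply: (section_poly_interpolation (kk := frac_scalar) _ _ _ Ninf).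
- exact: subring_set0.
- exact: subring_setB.
- by move=> l' x; apply: localization_scalar.
by move=> l [].
Qed.

End FractionSections.

(** The rows of A span the relations over E between the entries of s, so u s = 0 exactly when u C =
    0, with C the cokernel matrix of A. A rank factorization C = P Q with L P = 1 gives e = L s,
    free because Q is, and s = P e. *)
Lemma free_coordinates (E K : fieldType) (iota : {rmorphism E -> K}) r (s :
  'cV[K]_r) :
  exists d (e : 'cV[K]_d) (M : 'M[E]_(r, d)),
    (forall u : 'rV[E]_d, map_mx iota u *m e = 0 ->
      u = 0) /\ s = map_mx iota M *m e.
Proof.
have [q [A [As As']]] := finite_span [set u :
  'rV[E]_r | map_mx iota u *m s = 0].
have AP (u : 'rV_r) : map_mx iota u *m s = 0 -> u *m cokermx A = 0.
  by move=> /As' /submxP[D ->]; rewrite -mulmxA mulmx_coker mulmx0.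
have As0 (u : 'rV_r) : u *m cokermx A = 0 -> map_mx iota u *m s = 0.
  move=> uA; have /submxP[D ->] : (u <= A)%MS by rewrite submxE uA.
  have As00 : map_mx iota A *m s = 0.
    by apply/row_matrixP => i; rewrite row_mul -map_row row0; apply: As.
  by rewrite map_mxM -mulmxA As00 mulmx0.
set C := cokermx A in AP As0.
have [d [P [Q [L [CE LP Qfree]]]]] : exists d (P : 'M_(r, d)) (Q : 'M_(d, r)) L,
    [/\ C = P *m Q, L *m P = 1%:M & row_free Q].
  have /row_fullP[L LP] := col_base_full C.
  by exists _, (col_base C), (row_base C), L; rewrite mulmx_base row_base_free.
exists d, (map_mx iota L *m s), P; split.
  move=> u; rewrite mulmxA -map_mxM => /AP.
  rewrite CE mulmxA -(mulmxA u) LP mulmx1 => /eqP.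
  by rewrite mulmx_free_eq0 // => /eqP.
apply/eqP; rewrite -subr_eq0 mulmxA -map_mxM -[X in X - _]mul1mx -(map_mx1
  iota).
rewrite -mulmxBl -map_mxB; apply/eqP/row_matrixP => i.
rewrite row_mul -map_row row0; apply: As0; rewrite -row_mul CE.
by rewrite mulmxA mulmxBl mul1mx -mulmxA LP mulmx1 subrr mul0mx row0.
Qed.

Section EisensteinSections.
Variables (O : idomainType) (hO : ufd O) (k : fieldType) (j : {rmorphism k ->
  O}).
Variables (K : fieldType) (iota : {rmorphism {fraction O} -> K}).
Hypothesis K_alg : forall z : K, algebraicOver iota z.
Local Notation E := {fraction O}.
Local Notation D := (eisenstein_rings iota).

Definition field_scalar : {rmorphism k -> K} := iota \o frac_scalar j.

Lemma adjoin_bounded_row f c N x : adjoin_bounded iota f c N ->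
    adjoin (frac_ring iota f) c x ->
  exists u : 'rV[E]_N, (forall i, localization f (u 0 i)) /\
    map_mx iota u *m (\col_i c ^+ i) = x%:M.
Proof.
move=> fN /fN[P [fP sP ->]]; exists (\row_i P`_i).
split=> [i|]; first by rewrite mxE.
apply/matrixP => a b; rewrite !ord1 !mxE eqxx mulr1n.
rewrite (@horner_coef_wide _ N); last exact: leq_trans (size_poly _ _) sP.
by apply: eq_bigr => i _; rewrite !mxE coef_map.
Qed.

Section CoefficientSpan.
Variables (n : nat) (F : {mps K[n.+2]}).

Definition coef_col N : 'cV[K]_#|{: 'X_{1..n.+2 < N}}| :=
  \col_i F (enum_val i : 'X_{1..n.+2 < N}).

Definition coef_span N : set K :=
  [set x | exists a, map_mx iota a *m coef_col N = x%:M].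

Lemma coef_spanB N x y : coef_span N x -> coef_span N y -> coef_span N (x - y).
Proof.
by move=> [a aE] [b bE]; exists (a - b); rewrite map_mxB mulmxBl aE bE raddfB.
Qed.

Lemma coef_spanZ N c x : coef_span N x -> coef_span N (iota c * x).
Proof.
by move=> [a aE]; exists (c *: a); rewrite map_mxZ -scalemxAl aE
  scale_scalar_mx.
Qed.

Lemma coef_span0 N : coef_span N 0.
Proof. by exists 0; rewrite map_mx0 mul0mx raddf0. Qed.

Lemma coef_span_gen N m : (mdeg m < N)%N -> coef_span N (F m).
Proof.
move=> lt_mN; exists (delta_mx 0 (enum_rank (BMultinom lt_mN))).
rewrite map_delta_mx -rowE; apply/matrixP => a b.
by rewrite !ord1 !mxE enum_rankK eqxx mulr1n.
Qed.

Lemma coef_span_sum N I (r : seq I) (G : I -> K) :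
  (forall i, coef_span N (G i)) -> coef_span N (\sum_(i <- r) G i).
Proof.
move=> VG; apply: big_ind => // [|x y Vx Vy]; first exact: coef_span0.
rewrite -[y]opprK; apply: coef_spanB => //; rewrite -sub0r.
by apply: coef_spanB => //; apply: coef_span0.
Qed.

(** At a given l the section has its coefficients in some O_f[c], so they are combinations over
    Frac(O) of finitely many of them, at exponents b_i. These involve only coefficients of F of
    degree at most max |b_i|, whence an N depending on l, constant on an infinite set by
    pigeonhole. *)
Lemma coef_span_finite (L : set k) : ~ countable L ->
    (forall l, L l -> directed_series D
       (mps_subst (tuple_last (@mpsX n.+1 K) (field_scalar l *: mpsX K ord0))
         F)) ->
  exists N, forall m, coef_span N (F m).
Proof.
move=> L_unc LF.
have VM N l x : coef_span N x -> coef_span N (field_scalar l * x).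
  exact: coef_spanZ.
have [|N Ninf] := @uncountable_pigeonhole _ L (fun N =>
    [set l | forall m, coef_span N (section_poly F m).[field_scalar l]]) L_unc.
  move=> l /LF [_ [f [c [f0 -> [N fN]]]] fF].
  have /choice[u uP] m := adjoin_bounded_row fN (fF m).
  have [r [A [Au uA]]] := finite_span (range u).
  have /choice[b bE] i : exists m, u m = row i A by have [m _ um] := Au i;
    exists m.
  exists (\max_i mdeg (b i)).+1 => m.
  have /submxP[C CE] : (u m <= A)%MS by apply: uA; exists m.
  rewrite -section_polyE.
  have -> : mps_subst (tuple_last (@mpsX n.+1 K) (field_scalar l *: mpsX K
    ord0)) F m
      = \sum_i iota (C 0 i) * (section_poly F (b i)).[field_scalar l].
    have [_ /matrixP/(_ 0 0)] := uP m; rewrite [RHS]mxE eqxx mulr1n => <-.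
    rewrite CE map_mxM -mulmxA mxE; apply: eq_bigr => i _.
    rewrite mxE; congr (_ * _); rewrite -section_polyE.
    have [_ /matrixP/(_ 0 0)] := uP (b i); rewrite [RHS]mxE eqxx mulr1n => <-.
    by rewrite bE !mxE; apply: eq_bigr => a _; rewrite !mxE.
  apply: coef_span_sum => i; apply: coef_spanZ.
  apply: section_poly_in; [exact: coef_span0|exact: coef_spanB|exact: VM|].
  move=> m' le_m'; apply: coef_span_gen; rewrite ltnS (leq_trans le_m') //.
  exact: leq_bigmax.
exists N; apply: (section_poly_interpolation (kk := field_scalar) _ _ _ Ninf).
- exact: coef_span0.
- exact: coef_spanB.
- exact: VM.
by move=> l [].
Qed.

End CoefficientSpan.

Hypothesis char0 : [pchar O] =i pred0.

Lemma eisenstein_sections n (F : {mps K[n.+2]}) (L : set k) : ~ countable L ->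
    (forall l, L l -> directed_series D
       (mps_subst (tuple_last (@mpsX n.+1 K) (field_scalar l *: mpsX K ord0))
         F)) ->
  directed_series D F.
Proof.
move=> L_unc LF; have [N /choice[a aE]] := coef_span_finite L_unc LF.
(* The coefficients of F are combinations of the free family e; each coordinate is a series over
   Frac(O), to which [frac_sections] applies. *)
have [d [e [M [e_free sE]]]] := free_coordinates iota (coef_col F N).
pose w m := a m *m M.
have wE m : map_mx iota (w m) *m e = (F m)%:M by rewrite map_mxM -mulmxA -sE aE.
have FE m : F m = \sum_i iota (w m 0 i) * e i 0.
  have /matrixP/(_ 0 0) := wE m; rewrite [RHS]mxE eqxx mulr1n => <-.
  by rewrite mxE; apply: eq_bigr => i _; rewrite mxE.
have /choice[f fP] (i : 'I_d) : exists f, f != 0 /\ forall m,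
  localization f (w m 0 i).
  pose G : 'I_d -> {mps E[n.+2]} := fun i => MPS (fun m => w m 0 i).
  suff [f f0 fG] : exists2 f, f != 0 & forall m,
    localization f (G i m) by exists f.
  apply: (frac_sections hO (j := j) L_unc) => l /LF[_ [f [c [f0 ->
    [N' fN]]]] fF].
  have /choice[u uP] m := adjoin_bounded_row fN (fF m).
  set cp := (\col_i c ^+ i) in uP.
  (* The section has coordinates in O_f relative to the powers of c; they are wanted relative to e.
     Both families are expressed in a common free family e'. As e is free its matrix has a right
     inverse T, so the change of coordinates is one matrix over Frac(O), whose denominators g
     absorbs. *)
  have [d' [e' [M' [e'_free tE]]]] := free_coordinates iota (col_mx e cp).
  rewrite -[M']vsubmxK map_col_mx mul_col_mx in tE.
  have [eE cpE] := eq_col_mx tE.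
  have /row_freeP[T MT] : row_free (usubmx M').
    apply: inj_row_free => v vM; apply: e_free.
    by rewrite eE mulmxA -map_mxM vM map_mx0 mul0mx.
  have [g [g0 fg gMT]] := localization_seq
    [seq (dsubmx M' *m T) b.1 b.2 | b : 'I_N' * 'I_d] f0.
  exists g => // m.
  pose wl := \row_i (section_poly (G i) m).[frac_scalar j l].
  have wlE : map_mx iota wl *m e = ((section_poly F m).[field_scalar l])%:M.
    apply/matrixP => x y; rewrite !ord1 [RHS]mxE eqxx mulr1n mxE.
    rewrite section_poly_horner.
    under [RHS]eq_bigr do rewrite FE mulr_suml.
    rewrite exchange_big; apply: eq_bigr => b _.
    rewrite !mxE section_poly_horner rmorph_sum mulr_suml;
      apply: eq_bigr => m' _.
    by rewrite rmorphM rmorphXn mulrAC.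
  have {}wlE : wl = u m *m (dsubmx M' *m T).
    have [_ uE] := uP m; rewrite section_polyE -wlE in uE.
    rewrite mulmxA -[LHS]mulmx1 -MT mulmxA; congr (_ *m T); apply/eqP.
    rewrite -subr_eq0; apply/eqP/e'_free.
    by rewrite map_mxB !map_mxM mulmxBl -!mulmxA -eE -cpE uE subrr.
  have -> : (section_poly (G i) m).[frac_scalar j l] = wl 0 i by rewrite mxE.
  have sg := localization_subring g0.
  rewrite wlE mxE; apply: subring_set_sum => // b _; apply: (subring_setM sg).
    by apply: fg; have [] := uP m.
  by apply: gMT; apply/mapP; exists (b, i); rewrite ?mem_enum.
have f0 i : f i != 0 by have [] := fP i.
have F0 : \prod_i f i != 0 by apply/prodf_neq0 => i _; apply: f0.
have dirD := eisenstein_directed K_alg char0.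
have [B1 [DB1 fB1 _]] := eisenstein_ring_exists K_alg 0 F0.
have [B [DB B1B Be]] := directed_seq dirD [seq e i 0 | i : 'I_d] DB1.
exists B => // m; have sB := directed_subring dirD DB; rewrite FE.
apply: subring_set_sum => // i _; apply: (subring_setM sB).
  apply/B1B/fB1/adjoin_base.
    exact: subring_set0 (frac_ring_subring iota F0).
  exists (w m 0 i) => //; rewrite (bigD1 i) //=.
  apply: (localization_mulr (f0 i)); last by have [] := fP i.
  by apply/prodf_neq0 => i' _; apply: f0.
by apply: Be; apply/mapP; exists i; rewrite ?mem_enum.
Qed.

End EisensteinSections.

Lemma countable_preimage_inj T U (f : T -> U) (A : set U) :
  injective f -> countable A -> countable (f @^-1` A).
Proof.
move=> f_inj /countable_injP[g g_inj]; apply/countable_injP; exists (g \o f).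
move=> x y; rewrite !inE => Ax Ay /= e; apply: f_inj.
by apply: g_inj; rewrite ?inE.
Qed.

Theorem proposition4p9 (O : idomainType) (hO : ufd O)
    (k : fieldType) (j : {rmorphism k -> O})
    (k_uncountable : ~ countable [set: k]) (k_char0 : [pchar k] =i pred0)
    (K : closedFieldType) (iota : {rmorphism {fraction O} -> K})
    (K_alg : forall z : K, algebraicOver iota z) :
  W_temperate (eisenstein iota).
Proof.
have O_char0 : [pchar O] =i pred0 by move=> p; rewrite (fmorph_pchar j) k_char0.
have K_char0 : [pchar K] =i pred0.
  by move=> p; rewrite (fmorph_pchar (field_scalar j iota)) k_char0.
have dirD := eisenstein_directed K_alg O_char0.
have -> : eisenstein iota = directed_series (eisenstein_rings iota).
  by apply: functional_extensionality_dep => n; apply: eisensteinE.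
have kK_inj : injective (field_scalar j iota) by apply: fmorph_inj.
split.
- by move=> /(countable_preimage_inj kK_inj); rewrite preimage_setT.
- exact: directed_series_weierstrass.
- by move=> n f; apply: directed_series_blowup.
- move=> n F AF W W_count; apply: AF.
  apply: (eisenstein_sections hO (j := j) K_alg O_char0 (L :=
    field_scalar j iota @^-1` W)) => //.
  (* The elements of k that map into W are uncountably many: those that map outside W are countably
     many by assumption, and k is the union of the two. *)
  move=> L_count; apply: k_uncountable.
  have -> : [set: k] = \bigcup_(b in [set: bool])
      field_scalar j iota @^-1` (if b then W else ~` W).
    apply/seteqP; split=> // l _.
    by have [Wl|Wl] := pselect (W (field_scalar j iota l));
      [exists true|exists false].
  apply: bigcup_countable => // -[] _ //.
  exact: countable_preimage_inj.
move=> alpha Gamma g g' P p GammaK at_x2 _ G_irr G_monic _ Ag Ag' /rootP gG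
  /rootP g'G Pp _.
exact: (directed_series_conj dirD G_irr G_monic Ag Ag' gG g'G Pp).
Qed.
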